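(* Let $(R,\mathfrak{m})$ be a one dimensional commutative Noetherian local domain with quotient field $Q$ and $\mathfrak{m}$-adic completion $\hat{R}$, and let $E = E_R(R/\mathfrak{m})$ be the injective hull of the residue field. Let $\operatorname{Ass} \hat{R} = \{\mathfrak{q}_1,\ldots,\mathfrak{q}_r\}$ be the set of associated prime ideals of $\hat{R}$ (with $\mathfrak{q}_1,\ldots,\mathfrak{q}_r$ pairwise distinct). Then there are isomorphisms \[ \operatorname{Hom}_R(Q,E) \simeq \bigoplus_{i=1}^r E_{\hat{R}}(\hat{R}/\mathfrak{q}_i) \quad\text{and}\quad Q\otimes_R \hat{R} \simeq \bigoplus_{i=1}^r \widehat{\hat{R}_{\mathfrak{q}_i}}, \] where $\widehat{\hat{R}_{\mathfrak{q}_i}}$ denotes the completion of $\hat{R}_{\mathfrak{q}_i}$, $i = 1,\ldots,r$.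
   Context: $E_{S}(M)$ denotes the injective hull of a module $M$ over the ring $S$. The completion of the local ring $\hat{R}_{\mathfrak{q}_i}$ is taken with respect to its maximal ideal. Since every element of $E$ is annihilated by a power of $\mathfrak{m}$, $E$ has a natural $\hat{R}$-module structure compatible with its $R$-module structure, and $\operatorname{Hom}_R(Q,E)$ is an $\hat{R}$-module via this structure on $E$. The isomorphisms are isomorphisms of $\hat{R}$-modules. *)

(* Defs.v *)
From HB Require Import structures.
From mathcomp Require Import all_boot all_algebra.
From mathcomp Require Import boolp classical_sets functions.

Set Implicit Arguments.
Unset Strict Implicit.
Unset Printing Implicit Defensive.

Import GRing.Theory.
Local Open Scope classical_set_scope.
Local Open Scope ring_scope.

(* Ideals are arbitrary (not necessarily decidable or proper) subsets, which   *)
(* is why idealr and prime_idealr of ring_quotient are not used.               *)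
Section Ideals.
Variable A : comNzRingType.
Implicit Types (I J P m : set A).

Definition ideal I :=
  [/\ I 0, (forall x y, I x -> I y -> I (x + y))
    & (forall a x, I x -> I (a * x))].

Definition prime_ideal P :=
  [/\ ideal P, ~ P 1 & forall x y, P (x * y) -> P x \/ P y].

Definition maximal_ideal m :=
  [/\ ideal m, ~ m 1 & forall I, ideal I -> ~ I 1 -> m `<=` I -> I = m].

Definition ideal_gen (X : set A) : set A := smallest ideal X.

Definition ideal_mul I J : set A :=
  ideal_gen [set z | exists x y, [/\ I x, J y & z = x * y]].

Definition ideal_exp I (n : nat) : set A := iter n (ideal_mul I) setT.

Definition noetherian_ring :=
  forall I, ideal I -> exists s : seq A, I = ideal_gen [set` s].

Definition local_ring m :=
  maximal_ideal m /\ (forall n, maximal_ideal n -> n = m).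

(* p 0 `<` p 1 `<` ... `<` p n; the values p i with n < i are irrelevant. *)
Definition prime_chain (n : nat) (p : nat -> set A) :=
  (forall i, (i <= n)%N -> prime_ideal (p i)) /\
  (forall i, (i < n)%N -> p i `<` p i.+1).

Definition krull_dim (d : nat) :=
  (exists p, prime_chain d p) /\
  (forall n p, prime_chain n p -> (n <= d)%N).

End Ideals.

(* phi : A -> B exhibits B as the I-adic completion of A, i.e. as the inverse  *)
(* limit of the A / I ^ n.  The ideal K n is the kernel of the projection      *)
(* B -> A / I ^ n: the first four clauses say that phi induces compatible      *)
(* isomorphisms A / I ^ n -> B / K n, the last one that B -> lim A / I ^ n is  *)
(* bijective.                                                                  *)
Definition adic_completion (A B : comNzRingType) (I : set A)
    (phi : {rmorphism A -> B}) :=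
  exists K : nat -> set B,
    [/\ (forall n, ideal (K n)),
        (forall n, K n.+1 `<=` K n),
        (forall n, phi @^-1` K n = ideal_exp I n),
        (forall n b, exists a, K n (b - phi a))
      & (forall x : nat -> A, (forall n, ideal_exp I n (x n.+1 - x n)) ->
          exists! b : B, forall n, K n (b - phi (x n)))].

(* l : A -> L exhibits L as the localization of A at the prime ideal P: every  *)
(* element of L is a fraction l a / l s with s outside P, and l a vanishes iff *)
(* a is killed by some s outside P.                                            *)
Definition localization (A L : comNzRingType) (P : set A)
    (l : {rmorphism A -> L}) :=
  [/\ (forall s, ~ P s -> exists t, l s * t = 1),
      (forall x, exists a s, ~ P s /\ l s * x = l a)
    & (forall a, l a = 0 <-> exists s, ~ P s /\ s * a = 0)].

(* Restriction of scalars along f. *)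
Definition restr (A B : comNzRingType) (f : {rmorphism A -> B})
  (M : lmodType B) : Type := M.

Section RestrictionOfScalars.
Variables (A B : comNzRingType) (f : {rmorphism A -> B}) (M : lmodType B).

HB.instance Definition _ := GRing.Zmodule.copy (restr f M) M.

Let scale (a : A) (x : restr f M) : restr f M := f a *: (x : M).

Fact restr_scaleA a b x : scale a (scale b x) = scale (a * b) x.
Proof. by rewrite /scale scalerA rmorphM. Qed.

Fact restr_scale1 : left_id 1 scale.
Proof. by move=> x; rewrite /scale rmorph1 scale1r. Qed.

Fact restr_scaleDr : right_distributive scale +%R.
Proof. by move=> a x y; rewrite /scale scalerDr. Qed.

Fact restr_scaleDl x : {morph scale^~ x : a b / a + b}.
Proof. by move=> a b; rewrite /scale rmorphD scalerDl. Qed.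

HB.instance Definition _ := GRing.Zmodule_isLmodule.Build A (restr f M)
  restr_scaleA restr_scale1 restr_scaleDr restr_scaleDl.

End RestrictionOfScalars.

(* Hom_A(M, E) for E a module over the A-algebra f : A -> B, with the          *)
(* B-module structure coming from E: (b g) x = b (g x).                        *)
Section Hom.
Variables (A B : comNzRingType) (f : {rmorphism A -> B}).
Variables (M : lmodType A) (E : lmodType B).

Definition is_hom : {pred (M -> E)} :=
  [pred g : M -> E | `[< linear (g : M -> restr f E) >]].

Fact is_hom_submod_closed : submod_closed is_hom.
Proof.
split=> [|b g h /asboolP gP /asboolP hP].
  apply: asboolT => a x y; rewrite -[LHS]/(0 : E).
  by rewrite -[RHS]/(f a *: (0 : E) + 0) scaler0 addr0.
apply: asboolT => a x y.
rewrite -[LHS]/(b *: g (a *: x + y) + h (a *: x + y)) gP hP.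
rewrite -[RHS]/(f a *: (b *: g x + h x) + (b *: g y + h y)).
rewrite -[a *: (g x : restr f E)]/(f a *: g x).
rewrite -[a *: (h x : restr f E)]/(f a *: h x).
rewrite (scalerDr b (f a *: g x) (g y)) scalerDr !scalerA [f a * b]mulrC.
exact: (@addrACA E).
Qed.

HB.instance Definition _ :=
  GRing.isSubmodClosed.Build B (M -> E) is_hom is_hom_submod_closed.

Record modhom := ModHom { modhom_fun :> M -> E; _ : modhom_fun \in is_hom }.

HB.instance Definition _ := [isSub for modhom_fun].
HB.instance Definition _ := [Choice of modhom by <:].
HB.instance Definition _ := [SubChoice_isSubLmodule of modhom by <:].

End Hom.

(* Direct sum of a finite family of modules, as a module of families. *)
Definition dsum (A : comNzRingType) (I : finType) (M : I -> lmodType A) : Type :=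
  forall i, M i.

Section DirectSum.
Variables (A : comNzRingType) (I : finType) (M : I -> lmodType A).
Implicit Types x y z : dsum M.

HB.instance Definition _ := gen_eqMixin (dsum M).
HB.instance Definition _ := gen_choiceMixin (dsum M).

Let zero : dsum M := fun=> 0.
Let opp x : dsum M := fun i => - x i.
Let add x y : dsum M := fun i => x i + y i.
Let scale (a : A) x : dsum M := fun i => a *: x i.

Fact dsum_addA : associative add.
Proof. by move=> x y z; apply: functional_extensionality_dep => i; apply: addrA. Qed.

Fact dsum_addC : commutative add.
Proof. by move=> x y; apply: functional_extensionality_dep => i; apply: addrC. Qed.

Fact dsum_add0 : left_id zero add.
Proof. by move=> x; apply: functional_extensionality_dep => i; apply: add0r. Qed.

Fact dsum_addN : left_inverse zero opp add.
Proof. by move=> x; apply: functional_extensionality_dep => i; apply: addNr. Qed.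

HB.instance Definition _ := GRing.isZmodule.Build (dsum M)
  dsum_addA dsum_addC dsum_add0 dsum_addN.

Fact dsum_scaleA a b x : scale a (scale b x) = scale (a * b) x.
Proof. by apply: functional_extensionality_dep => i; apply: scalerA. Qed.

Fact dsum_scale1 : left_id 1 scale.
Proof. by move=> x; apply: functional_extensionality_dep => i; apply: scale1r. Qed.

Fact dsum_scaleDr : right_distributive scale +%R.
Proof. by move=> a x y; apply: functional_extensionality_dep => i; apply: scalerDr. Qed.

Fact dsum_scaleDl x : {morph scale^~ x : a b / a + b}.
Proof. by move=> a b; apply: functional_extensionality_dep => i; apply: scalerDl. Qed.

HB.instance Definition _ := GRing.Zmodule_isLmodule.Build A (dsum M)
  dsum_scaleA dsum_scale1 dsum_scaleDr dsum_scaleDl.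

End DirectSum.

Section Modules.
Variable A : comNzRingType.

Definition mod_iso (M N : lmodType A) := exists f : {linear M -> N}, bijective f.

Definition annihilator (M : lmodType A) (x : M) : set A := [set a | a *: x = 0].

Definition Ass (M : lmodType A) : set (set A) :=
  [set P | prime_ideal P /\ exists x : M, P = annihilator x].

Definition submodule (M : lmodType A) (N : set M) :=
  [/\ N 0, (forall x y, N x -> N y -> N (x + y))
    & (forall a x, N x -> N (a *: x))].

Definition injective_module (E : lmodType A) :=
  forall (M N : lmodType A) (i : {linear M -> N}) (g : {linear M -> E}),
    injective i -> exists h : {linear N -> E}, forall x, h (i x) = g x.

Definition essential (M E : lmodType A) (i : {linear M -> E}) :=
  injective i /\
  forall N : set E, submodule N -> N `&` range i = [set 0] -> N = [set 0].

Definition injective_hull (M E : lmodType A) (i : {linear M -> E}) :=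
  injective_module E /\ essential i.

Definition cyclic_quotient (P : set A) (K : lmodType A)
    (p : {linear A^o -> K}) :=
  (forall y, exists x, p x = y) /\ (forall x, p x = 0 <-> P x).

(* E is an injective hull of A / P. *)
Definition hull_of_quotient (P : set A) (E : lmodType A) :=
  exists (K : lmodType A) (p : {linear A^o -> K}) (i : {linear K -> E}),
    cyclic_quotient P p /\ injective_hull i.

Definition tensor_product (M N T : lmodType A) (t : {bilinear M -> N -> T}) :=
  forall (W : lmodType A) (u : {bilinear M -> N -> W}),
    exists h : {linear T -> W}, (forall x y, h (t x y) = u x y) /\
      forall h' : {linear T -> W}, (forall x y, h' (t x y) = u x y) -> h' =1 h.

End Modules.

(* The B-module T is the base change of the A-module M to f : A -> B: its      *)
(* A-module is the tensor product of M and B over A by t, and B acts through   *)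
(* the right factor.                                                           *)
Definition base_change (A B : comNzRingType) (f : {rmorphism A -> B})
    (M : lmodType A) (T : lmodType B)
    (t : {bilinear M -> restr f B^o -> restr f T}) :=
  tensor_product t /\
  forall x (b c : B), t x (b * c) = b *: (t x c : T) :> T.

Definition frac_module (R : idomainType) : lmodType R :=
  restr (@tofrac R) {fraction R}^o.

(* Main.v *)
(* Let a be a nonzero element of m and t its image in A = Rh.  As R / a is      *)
(* artinian, A is t-adically complete, t is regular on A, and A / t is         *)
(* artinian.  An ideal I is saturated when t x in I implies x in I, i.e. when  *)
(* it comes from S = A[1/t], which is the tensor product of Q and A.  By       *)
(* completeness, nested saturated ideals with the same image in A / t are      *)
(* equal, so the chain conditions of A / t pass to S: S is artinian, its       *)
(* primes are those of Ass A, and S is the product of the local rings A_(q i), *)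
(* which are complete because their maximal ideals are nilpotent.              *)
(*                                                                             *)
(* V = Hom_R(Q, E) is the module of sequences in E with t e_(n+1) = e_n.  It   *)
(* splits along the idempotents of S.  Maps from saturated ideals to V extend  *)
(* to A, because Artin-Rees is trivial for saturated ideals.  The elements of  *)
(* V killed by q i form a line over Frac (A / q i): if f is one of them, the   *)
(* annihilators of the f_n shrink to q i, hence t-adically so by Chevalley's   *)
(* argument, and double annihilation in E writes g_n = d_n f_n with (d_n)      *)
(* convergent.  Hence the i-th component of V is the hull of A / q i.          *)

Require Import Defs.
From HB Require Import structures.
From mathcomp Require Import all_boot all_algebra.
From mathcomp Require Import boolp classical_sets functions.
From mathcomp Require Import generic_quotient ring.

Set Implicit Arguments.
Unset Strict Implicit.
Unset Printing Implicit Defensive.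

Import GRing.Theory.
Local Open Scope classical_set_scope.
Local Open Scope ring_scope.

(** * Ideals *)

(** Let [a] be a nonzero element of [m] and [t] its image in [A = Rh]. In dimension one the powers
    of [a] and of [m] define the same topology ([dim1_exp_sub_principal]), so [Q = R[1/a]] and [A]
    is [t]-adically complete with [A / t = R / a] ([completion_adic_ring]). Both claims thus concern
    [S = A[1/t]], which is never constructed: its ideals are the saturated ideals of [A], and its
    identities are written after clearing a power of [t].

    By the Nakayama argument [saturated_sub], [S] is artinian. Its local rings have nilpotent
    maximal ideals ([prime_nilpotent]), so they equal their completions [C i], and the Chinese
    remainder theorem gives [S = prod C i] ([localizations_injective], [localizations_surjective]);
    [base_change_frac_iso] reads this as a statement about the tensor product.

    A homomorphism from [Q] to [E] is the sequence of its values at the [a^-n]; these form an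
    [S]-module [V], split by the idempotents of [S]. For each [q i], [V] contains an element with
    annihilator [q i] ([limit_annihilated]), the elements killed by [q i] form a line over the
    fraction field of [A / q i] ([limit_one_dim], through double annihilation in [E]), and maps from
    saturated ideals to [V] extend ([limit_baer]). These three facts make the [i]-th component the
    hull of [A / q i] ([limit_component]). *)

Section Ideals.
Variable A : comNzRingType.
Implicit Types (I J P m : set A) (x y : A).

Lemma idealN I x : ideal I -> I x -> I (- x).
Proof. by case=> _ _ IM Ix; rewrite -mulN1r; apply: IM. Qed.

Lemma idealB I x y : ideal I -> I x -> I y -> I (x - y).
Proof. by move=> idI Ix Iy; case: (idI) => _ + _; apply=> //; apply: idealN. Qed.

Lemma idealMr I a x : ideal I -> I x -> I (x * a).
Proof. by case=> _ _ IM Ix; rewrite mulrC; apply: IM. Qed.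

Lemma ideal_sum I (K : Type) (s : seq K) (P : pred K) (F : K -> A) :
  ideal I -> (forall j, I (F j)) -> I (\sum_(j <- s | P j) F j).
Proof. by case=> I0 ID _ IF; apply: big_ind. Qed.

Lemma prime_idealX P x k : prime_ideal P -> P (x ^+ k) -> P x.
Proof.
case=> _ P1 PM; elim: k => [|k IHk]; first by rewrite expr0.
by rewrite exprS => /PM[].
Qed.

Definition ideal_adj I x : set A := [set z | exists y r, I y /\ z = y + r * x].

Lemma ideal_adj_ideal I x : ideal I -> ideal (ideal_adj I x).
Proof.
case=> I0 ID IM; split.
- by exists 0, 0; rewrite mul0r addr0.
- move=> _ _ [y [r [Iy ->]]] [z [s [Iz ->]]].
  by exists (y + z), (r + s); split; [apply: ID | ring].
- move=> a _ [y [r [Iy ->]]]; exists (a * y), (a * r).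
  by split; [apply: IM | ring].
Qed.

Lemma sub_ideal_adj I x : I `<=` ideal_adj I x.
Proof. by move=> y Iy; exists y, 0; rewrite mul0r addr0. Qed.

Lemma mem_ideal_adj I x : ideal I -> ideal_adj I x x.
Proof. by case=> I0 _ _; exists 0, 1; rewrite mul1r add0r. Qed.

Lemma ideal_gen_ideal (X : set A) : ideal (ideal_gen X).
Proof.
split=> [|x y genx geny|a x genx] J JX; have [[J0 JD JM] _] := JX => //.
  by apply: JD; [exact: (genx J) | exact: (geny J)].
by apply: JM; exact: (genx J).
Qed.

Lemma sub_ideal_gen (X : set A) : X `<=` ideal_gen X.
Proof. by move=> x Xx J [_]; apply. Qed.

Lemma ideal_gen_sub (X : set A) I : ideal I -> X `<=` I -> ideal_gen X `<=` I.
Proof. by move=> idI XI x; apply. Qed.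

Lemma ideal_gen_seqP (s : seq A) x : ideal_gen [set` s] x ->
  exists r : 'I_(size s) -> A, x = \sum_j r j * s`_j.
Proof.
pose S : set A := [set z | exists r : 'I_(size s) -> A, z = \sum_j r j * s`_j].
suff [idS sS] : ideal S /\ [set` s] `<=` S.
  by move=> genx; exact: (ideal_gen_sub idS sS genx).
split.
  split.
  - by exists (fun=> 0); rewrite big1 // => j _; rewrite mul0r.
  - move=> _ _ [r ->] [u ->]; exists (fun j => r j + u j).
    by rewrite -big_split; apply: eq_bigr => j _; rewrite mulrDl.
  - move=> a _ [r ->]; exists (fun j => a * r j).
    by rewrite big_distrr; apply: eq_bigr => j _; rewrite /= mulrA.
move=> y /= sy; have ys : (index y s < size s)%N by rewrite index_mem.
exists (fun j => (j == Ordinal ys)%:R).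
rewrite (bigD1 (Ordinal ys)) //= eqxx mul1r nth_index // big1 ?addr0 //.
by move=> j /negPf->; rewrite mul0r.
Qed.

Lemma mem_ideal_mul I J x y : I x -> J y -> ideal_mul I J (x * y).
Proof. by move=> Ix Jy; apply: sub_ideal_gen; exists x, y. Qed.

Lemma ideal_mul_sub I J K : ideal K ->
  (forall x y, I x -> J y -> K (x * y)) -> ideal_mul I J `<=` K.
Proof. by move=> idK IJK; apply: ideal_gen_sub => // _ [x [y [Ix Jy ->]]]; apply: IJK. Qed.

Lemma ideal_exp_ideal I k : ideal (ideal_exp I k).
Proof. by case: k => [|k]; [split | exact: ideal_gen_ideal]. Qed.

Lemma ideal_expS I k : ideal_exp I k.+1 `<=` ideal_exp I k.
Proof.
apply: ideal_mul_sub => [|x y _]; first exact: ideal_exp_ideal.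
by case: (ideal_exp_ideal I k) => _ _; apply.
Qed.

Lemma mem_ideal_expX I x k : I x -> ideal_exp I k (x ^+ k).
Proof.
move=> Ix; elim: k => // k IHk.
by rewrite exprS; apply: mem_ideal_mul.
Qed.

Lemma ideal_exp1 I : ideal I -> ideal_exp I 1 `<=` I.
Proof.
by move=> idI; apply: ideal_mul_sub => // x y Ix _; rewrite mulrC; case: idI => _ _; apply.
Qed.


(** Otherwise choice yields a strictly increasing sequence in [F]; its union is finitely generated,
    hence equal to one of its terms. *)
Lemma noetherian_max (F : set (set A)) :
  noetherian_ring A -> F !=set0 -> (forall I, F I -> ideal I) ->
  exists2 I, F I & forall J, F J -> I `<=` J -> J `<=` I.
Proof.
move=> noethA [I0 FI0] Fideal; apply: contrapT => noMax.
have /choice[next nextP] : forall I, exists J, F I ->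
    [/\ F J, I `<=` J & ~ J `<=` I].
  move=> I; apply: contrapT => noJ; apply: noMax; exists I.
    by apply: contrapT => nFI; apply: noJ; exists I => /nFI.
  by move=> J FJ IJ; apply: contrapT => nJI; apply: noJ; exists J.
pose c n := iter n next I0.
have Fc n : F (c n) by elim: n => //= n /nextP[].
have cS n : c n `<=` c n.+1 by case: (nextP _ (Fc n)).
have c_mono k l : (k <= l)%N -> c k `<=` c l.
  by move=> /subnK<-; elim: (l - k)%N => //= j IHj x /IHj; apply: cS.
pose U : set A := [set x | exists n, c n x].
have idU : ideal U.
  split.
  - by exists 0%N; case: (Fideal _ (Fc 0%N)).
  - move=> x y [k ckx] [l cly]; exists (maxn k l).
    case: (Fideal _ (Fc (maxn k l))) => _ + _; apply.
      by apply: c_mono ckx; apply: leq_maxl.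
    by apply: c_mono cly; apply: leq_maxr.
  - move=> a x [k ckx]; exists k.
    by case: (Fideal _ (Fc k)) => _ _; apply.
have [s Us] := noethA U idU.
have [N sN] : exists N, [set` s] `<=` c N.
  have : forall x, x \in s -> U x by move=> x xs; rewrite Us; apply: sub_ideal_gen.
  elim: {Us}s => [|x s IHs] sU; first by exists 0%N.
  have [N sN] := IHs (fun y ys => sU y (mem_behead (s := x :: s) ys)).
  have [k ckx] := sU x (mem_head _ _).
  exists (maxn k N) => y /=; rewrite inE => /orP[/eqP->|ys].
    by apply: c_mono ckx; apply: leq_maxl.
  by apply: (c_mono _ _ (leq_maxr k N)); apply: sN.
case: (nextP _ (Fc N)) => _ _; apply=> x cx.
suff: U x by rewrite Us; apply: ideal_gen_sub => //; apply: Fideal.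
by exists N.+1.
Qed.

Lemma principal_ideal y :
  ideal [set z | exists r, z = r * y].
Proof.
split; first by exists 0; rewrite mul0r.
  by move=> _ _ [r ->] [s ->]; exists (r + s); rewrite mulrDl.
by move=> b _ [r ->]; exists (b * r); rewrite mulrA.
Qed.

End Ideals.

Lemma preimage_ideal (A B : comNzRingType) (f : {rmorphism A -> B}) (I : set B) :
  ideal I -> ideal (f @^-1` I).
Proof.
move=> [I0 ID IM]; split=> /= [|x y fx fy|c x fx]; first by rewrite /= rmorph0.
  by rewrite /= rmorphD; apply: ID.
by rewrite /= rmorphM; apply: IM.
Qed.

(** * One dimensional noetherian local domains *)

Section LocalNoetherian.
Variables (A : comNzRingType) (m : set A).
Implicit Types (I J : set A) (x y : A).

Lemma ideal_exp_sub I J k l : ideal J ->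
    (forall x y, ideal_exp I k x -> ideal_exp I l y -> J (x * y)) ->
  ideal_exp I (k + l) `<=` J.
Proof.
elim: k J => [|k IHk] J idJ IJ.
  by move=> x Ix; rewrite -[x]mul1r; apply: IJ.
apply: ideal_mul_sub => // x y Ix.
suff: ideal_exp I (k + l) `<=` [set y | J (x * y)] by exact.
case: idJ => J0 JD JM; apply: IHk.
  split=> /= [|u v Ju Jv|a u Ju]; first by rewrite mulr0.
    by rewrite mulrDr; apply: JD.
  by rewrite mulrCA; apply: JM.
by move=> u v Iu Iv; rewrite /= mulrA; apply: IJ => //; apply: mem_ideal_mul.
Qed.

Lemma maximal_ideal_inv x : maximal_ideal m -> ~ m x ->
  exists c, m (1 - c * x).
Proof.
move=> [idm m1 max_m] mx; apply: contrapT => noinv; apply: mx.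
rewrite -(max_m (ideal_adj m x)); first exact: mem_ideal_adj.
- exact: ideal_adj_ideal.
- move=> [y [c [my e1]]]; apply: noinv; exists c.
  by rewrite e1 addrK.
- exact: sub_ideal_adj.
Qed.

Lemma proper_ideal_sub_maximal I : noetherian_ring A -> local_ring m ->
  ideal I -> ~ I 1 -> I `<=` m.
Proof.
move=> noethA [_ m_uniq] idI I1.
pose F : set (set A) := [set J | [/\ ideal J, ~ J 1 & I `<=` J]].
have [||J [idJ J1 IJ] maxJ] := noetherian_max (F := F) noethA.
- by exists I; split.
- by move=> J [].
rewrite -(m_uniq J) //; split=> // K idK K1 JK.
apply/seteqP; split=> //; apply: maxJ => //.
by split=> //; apply: subset_trans JK.
Qed.

(* Every ideal containing a power of m is reached from the bottom by           *)
(* extensions with quotient killed by m.                                       *)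
Lemma devissage (P : set A -> Prop) I0 N : noetherian_ring A ->
    ideal I0 -> ideal_exp m N `<=` I0 -> P I0 ->
    (forall I x, ideal I -> I0 `<=` I -> P I -> (forall y, m y -> I (y * x)) ->
      P (ideal_adj I x)) ->
  P setT.
Proof.
move=> noethA idI0 mI0 PI0 Padj.
pose F : set (set A) := [set I | [/\ ideal I, I0 `<=` I & P I]].
have [||I [idI I0I PI] maxI] := noetherian_max (F := F) noethA.
- by exists I0; split.
- by move=> I [].
suff I1 : I 1.
  rewrite -(_ : I = setT) //; apply/seteqP; split=> // x _.
  by rewrite -[x]mulr1; case: idI => _ _; apply.
apply: contrapT => I1.
(* The last power of [m] not contained in [I] supplies an [x] outside [I] with [m x] inside [I],
   against maximality. *)
have [j mjS mj] : exists2 j, ideal_exp m j.+1 `<=` I & ~ ideal_exp m j `<=` I.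
  have: ideal_exp m N `<=` I by exact: subset_trans I0I.
  elim: N {mI0} => [|N IHN] mI; first by case: I1; apply: mI.
  by have [/IHN //|nmI] := pselect (ideal_exp m N `<=` I); exists N.
apply: mj => x mx; apply: (maxI (ideal_adj I x)).
- split; first exact: ideal_adj_ideal.
    by apply: subset_trans I0I _; apply: sub_ideal_adj.
  by apply: Padj => // y my; apply: mjS; apply: mem_ideal_mul.
- exact: sub_ideal_adj.
- exact: mem_ideal_adj.
Qed.

Lemma artinian_dcc I0 N (D : nat -> set A) : noetherian_ring A ->
    maximal_ideal m -> ideal I0 -> ideal_exp m N `<=` I0 ->
    (forall k, ideal (D k)) -> (forall k, I0 `<=` D k) ->
    (forall k, D k.+1 `<=` D k) ->
  exists k0, forall k, (k0 <= k)%N -> D k0 `<=` D k.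
Proof.
move=> noethA max_m idI0 mI0 idD I0D decD.
have antiD k l : (k <= l)%N -> D l `<=` D k.
  by move=> /subnK<-; elim: (l - k)%N => //= j IHj x; rewrite addSn => /decD/IHj.
pose P U := exists k0, forall k, (k0 <= k)%N -> D k0 `&` U `<=` D k.
suff [k0 Dk0] : P setT by exists k0 => k le_k x Dx; apply: (Dk0 k le_k); split.
apply: (devissage noethA idI0 mI0).
  by exists 0%N => k _ x [_ I0x]; apply: I0D.
move=> U x idU I0U [k0 Dk0] mxU.
(* Either some term meets [U + A x] only inside [U], or every term from [k0] on contains some
   [v + c x] outside [U]; then [c] is invertible modulo [m], and a multiple of this element clears
   the [x]-part of [y]. *)
have [[k1 [le01 Dk1]]|noDk] := pselect (exists k1, (k0 <= k1)%N /\ 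
    D k1 `&` ideal_adj U x `<=` U).
  exists k1 => k le1 y [Dy Uy].
  by apply: (Dk0 k (leq_trans le01 le1)); split; [apply: antiD Dy | apply: Dk1].
exists k0 => k le_k y [Dy [u [r [Uu y_def]]]].
have [d [Dd [v [c [Uv d_def]]] Ud]] :
    exists d, [/\ D k d, ideal_adj U x d & ~ U d].
  apply: contrapT => nod; apply: noDk; exists k; split=> // d [Dd Ud].
  by apply: contrapT => nUd; apply: nod; exists d.
have [_ UD UM] := idU.
have [b mb] : exists b, m (1 - b * c).
  apply: maximal_ideal_inv => // mc; apply: Ud; rewrite d_def.
  by apply: UD => //; apply: mxU.
have -> : y = (y - r * b * d) + r * b * d by rewrite subrK.
have [_ DD DM] := idD k.
apply: (DD); last exact: DM.
apply: Dk0 => //; split.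
  apply: idealB => //; have [_ _] := idD k0; apply.
  exact: antiD Dd.
have -> : y - r * b * d = u - r * b * v + r * ((1 - b * c) * x).
  by rewrite y_def d_def; ring.
by apply: UD; [apply: idealB => //; apply: UM | apply: UM; apply: mxU].
Qed.

End LocalNoetherian.

Section DimensionOne.
Variables (R : idomainType) (m : set R).
Hypotheses (R_noetherian : noetherian_ring R) (R_local : local_ring m).
Hypothesis R_dim1 : krull_dim R 1.

(** An ideal maximal among those that contain [y] and no power of [m] is prime, since powers of [m]
    inside [P + (x)] and [P + (z)] multiply into [P + (x z)]. It would lie strictly between [0] and
    [m]. *)
Lemma dim1_exp_sub_principal y : y != 0 ->
  exists N, forall x, ideal_exp m N x -> exists r, x = r * y.
Proof.
move=> y_neq0; have [[idm m1 _] _] := R_local; apply: contrapT => noN.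
pose F : set (set R) :=
  [set I | [/\ ideal I, I y & forall k, ~ ideal_exp m k `<=` I]].
have [||P [idP Py Pexp] maxP] := noetherian_max (F := F) R_noetherian.
- exists [set z | exists r, z = r * y]; split.
  + exact: principal_ideal.
  + by exists 1; rewrite mul1r.
  + by move=> k mk; apply: noN; exists k.
- by move=> I [].
have P1 : ~ P 1.
  by move=> P1; apply: (Pexp 0%N) => x _; rewrite -[x]mulr1; case: idP => _ _; apply.
have adj_exp x : ~ P x -> exists k, ideal_exp m k `<=` ideal_adj P x.
  move=> Px; apply: contrapT => nok; apply: Px.
  apply: (maxP (ideal_adj P x)); last exact: mem_ideal_adj.
    split; [exact: ideal_adj_ideal | exact: sub_ideal_adj |].
    by move=> k mk; apply: nok; exists k.
  exact: sub_ideal_adj.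
have primeP : prime_ideal P.
  split=> // x z Pxz; apply: contrapT => /not_orP[/adj_exp[k mk] /adj_exp[l ml]].
  apply: (Pexp (k + l)%N); apply: ideal_exp_sub => // u v /mk[u' [r [Pu ->]]].
  move=> /ml[v' [s [Pv ->]]].
  have -> : (u' + r * x) * (v' + s * z) =
      (v' + s * z) * u' + r * x * v' + r * s * (x * z) by ring.
  by have [_ PD PM] := idP; do !apply: (PD); apply: (PM).
have [_ no_chain] := R_dim1.
pose p k : set R := if k is k'.+1 then if k' is 0%N then P else m else [set 0].
suff: (2 <= 1)%N by [].
apply: (no_chain 2%N p); split=> -[|[|[|]]] // _.
- split=> [|/eqP|x z /eqP]; rewrite /= ?oner_eq0 //.
    split=> //= [x z -> ->|a x ->]; first by rewrite addr0.
    by rewrite mulr0.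
  by rewrite mulf_eq0 => /orP[]/eqP; [left | right].
- split=> //= x z mxz; apply: contrapT => /not_orP[].
  move=> /(maximal_ideal_inv (proj1 R_local))[b mb].
  move=> /(maximal_ideal_inv (proj1 R_local))[c mc]; apply: m1.
  have -> : 1 = (1 - b * x) + b * x * (1 - c * z) + b * c * (x * z) by ring.
  by have [_ mD mM] := idm; do !apply: (mD) => //; apply: (mM).
- split=> [x ->|P0]; first by case: idP.
  by case/eqP: y_neq0; apply: P0.
- split; first exact: proper_ideal_sub_maximal.
  by move=> mP; apply: (Pexp 1%N); apply: subset_trans mP; apply: ideal_exp1.
Qed.

Lemma dim1_nonzero : exists2 a, a != 0 & m a.
Proof.
have [[p [p_prime p_lt]] _] := R_dim1.
have [p01 p10] := p_lt 0%N isT; have [idp p1 _] := p_prime 1%N isT.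
have [a [pa a_neq0]] : exists a, p 1%N a /\ a <> 0.
  apply: contrapT => noa; apply: p10 => x px.
  suff -> : x = 0 by have [[]] := p_prime 0%N isT.
  by apply: contrapT => x_neq0; apply: noa; exists x.
by exists a; [exact/eqP | apply: (proper_ideal_sub_maximal _ _ idp)].
Qed.

End DimensionOne.

(** * Saturated ideals of a t-adically complete ring *)

Definition saturated (A : comNzRingType) (t : A) (I : set A) :=
  forall x, I (t * x) -> I x.

(* The properties of the completion of a one dimensional local domain that     *)
(* matter here, t being the image of a nonzero element of the maximal ideal:   *)
(* A is t-adically complete, t is regular and A / t is artinian.               *)
Record adic_ring (A : comNzRingType) (t : A) : Prop := AdicRing {
  adic_regular : forall x, t * x = 0 -> x = 0;
  adic_separated : forall x, (forall k, exists z, x = t ^+ k * z) -> x = 0;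
  adic_complete : forall c : nat -> A, exists d,
    forall k, exists z, d = \sum_(i < k) t ^+ i * c i + t ^+ k * z;
  adic_fin_gen : forall I, ideal I -> exists (k : nat) (g : 'I_k -> A),
    (forall j, I (g j)) /\
    (forall x, I x -> exists r z, x = \sum_j r j * g j + t * z);
  adic_max : forall F : set (set A), F !=set0 ->
    (forall I, F I -> ideal I /\ I t) ->
    exists2 I, F I & forall J, F J -> I `<=` J -> J `<=` I;
  adic_dcc : forall N (D : nat -> set A), (forall k, ideal (D k)) ->
    (forall k, D k (t ^+ N)) -> (forall k, D k.+1 `<=` D k) ->
    exists k0, forall k, (k0 <= k)%N -> D k0 `<=` D k }.

Section AdicRing.
Variables (A : comNzRingType) (t : A).
Hypothesis At : adic_ring t.
Implicit Types (I J p q : set A) (x y z : A).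

Lemma adic_regularX k x : t ^+ k * x = 0 -> x = 0.
Proof.
elim: k => [|k IHk]; first by rewrite expr0 mul1r.
by rewrite exprS -mulrA => /(adic_regular At)/IHk.
Qed.

Lemma saturatedX I k x : saturated t I -> I (t ^+ k * x) -> I x.
Proof.
move=> satI; elim: k => [|k IHk]; first by rewrite expr0 mul1r.
by rewrite exprS -mulrA => /satI/IHk.
Qed.

Lemma prime_saturated p : prime_ideal p -> ~ p t -> saturated t p.
Proof. by move=> [_ _ pM] pt x /pM[]. Qed.

(* Lifts of generators of I modulo t generate J, by successive approximation.  *)
Lemma saturated_fin_gen I : ideal I ->
  exists (k : nat) (g : 'I_k -> A), (forall j, I (g j)) /\
    forall J, ideal J -> saturated t J -> I `<=` J -> J `<=` ideal_adj I t ->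
    forall x, J x -> exists r, x = \sum_j r j * g j.
Proof.
move=> idI; have [k [g [Ig genI]]] := adic_fin_gen At idI.
exists k, g; split=> // J idJ satJ IJ JI x Jx.
have /choice[F FP] : forall y, exists p : ('I_k -> A) * A, J y ->
    y = \sum_j p.1 j * g j + t * p.2 /\ J p.2.
  move=> y; have [Jy|] := pselect (J y); last by exists (fun=> 0, 0).
  have [i [r [Ii y_def]]] := JI y Jy; have [s [z i_def]] := genI i Ii.
  exists (s, z + r) => _; split=> /=; first by rewrite y_def i_def; ring.
  apply: satJ; have -> : t * (z + r) = y - \sum_j s j * g j.
    by rewrite y_def i_def; ring.
  apply: idealB => //; apply: ideal_sum => // j.
  by case: (idJ) => _ _; apply; apply: IJ.
(* [F y] is one division step, coefficients and remainder; [c n] is the remainder of [x] after [n]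
   steps, carrying the factor [t ^+ n]. *)
pose c n := iter n (fun y => (F y).2) x.
have Jc n : J (c n) by elim: n => //= n /FP[].
have /choice[d dP] j := adic_complete At (fun n => (F (c n)).1 j).
exists d; apply/subr0_eq; apply: (adic_separated At) => n.
have [z zP] := choice (fun j => dP j n).
exists (c n - \sum_j z j * g j).
have -> : x = \sum_j (\sum_(i < n) t ^+ i * (F (c i)).1 j) * g j + t ^+ n * c n.
  elim: n {z zP} => [|n IHn].
    rewrite expr0 mul1r big1 ?add0r // => j _.
    by rewrite big_ord0 mul0r.
  rewrite {1}IHn; have [{2}-> _] := FP _ (Jc n).
  rewrite mulrDr addrA exprSr mulrA; congr (_ + _).
  rewrite mulr_sumr -big_split; apply: eq_bigr => j _ /=.
  by rewrite big_ord_recr /=; ring.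
rewrite mulrBr -addrA [in RHS]addrC [in RHS]mulr_sumr addrCA addrC.
rewrite -sumrB addrC [RHS]addrC; congr (_ + _).
rewrite -sumrN; apply: eq_bigr => j _; rewrite {1}zP; ring.
Qed.

(** A Nakayama lemma drawn from completeness: generators of [I] modulo [t] already generate any
    saturated [J] above it with the same image in [A / t]. *)
Lemma saturated_sub I J : ideal I -> ideal J -> saturated t J ->
  I `<=` J -> J `<=` ideal_adj I t -> J `<=` I.
Proof.
move=> idI idJ satJ IJ JI x Jx; have [k [g [Ig genJ]]] := saturated_fin_gen idI.
have [r ->] := genJ J idJ satJ IJ JI x Jx.
by apply: ideal_sum => // j; case: idI => _ _; apply.
Qed.

Lemma saturated_max (F : set (set A)) : F !=set0 ->
    (forall I, F I -> ideal I /\ saturated t I) ->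
  exists2 I, F I & forall J, F J -> I `<=` J -> J `<=` I.
Proof.
move=> [I0 FI0] FP; pose G : set (set A) := [set J | exists2 I, F I & J = ideal_adj I t].
have [||J [I FI ->{J}] maxJ] := adic_max At (F := G).
- by exists (ideal_adj I0 t); exists I0.
- move=> _ [I /FP[idI _] ->]; split; first exact: ideal_adj_ideal.
  exact: mem_ideal_adj.
exists I => // J FJ IJ; have [[idI _] [idJ satJ]] := (FP I FI, FP J FJ).
apply: saturated_sub => //; apply: subset_trans (sub_ideal_adj _) _.
apply: maxJ; first by exists J.
by move=> _ [y [r [Iy ->]]]; exists y, r; split=> //; apply: IJ.
Qed.

Lemma saturated_dcc (D : nat -> set A) : (forall k, ideal (D k)) ->
    (forall k, saturated t (D k)) -> (forall k, D k.+1 `<=` D k) ->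
  exists k0, forall k, (k0 <= k)%N -> D k0 `<=` D k.
Proof.
move=> idD satD decD; have [|||k0 k0P] := adic_dcc At (N := 1) (D := fun k => ideal_adj (D k) t).
- by move=> k; apply: ideal_adj_ideal.
- by move=> k; rewrite expr1; apply: mem_ideal_adj.
- by move=> k _ [y [r [Dy ->]]]; exists y, r; split=> //; apply: decD.
exists k0 => k le_k; apply: saturated_sub => //.
  move: le_k => /subnK<-; elim: (k - k0)%N => //= j IHj x.
  by rewrite addSn => /decD/IHj.
by apply: subset_trans (sub_ideal_adj _) _; apply: k0P.
Qed.

Lemma prime_regularX p k : prime_ideal p -> ~ p t -> ~ p (t ^+ k).
Proof. by move=> pP pt /(prime_idealX pP). Qed.

Lemma prime_regular_mul p k x : prime_ideal p -> ~ p t -> p (t ^+ k * x) -> p x.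
Proof. by move=> pP pt; apply: saturatedX (prime_saturated pP pt). Qed.

(* A[1/t] is zero-dimensional. *)
Lemma saturated_prime_inv p s : prime_ideal p -> ~ p t -> ~ p s ->
  exists k z, p (t ^+ k - s * z).
Proof.
move=> pP pt ps; have [idp _ pM] := pP; have [p0 pD pZ] := idp.
(* [D k] is the contraction to [A] of the ideal [p + (s ^+ k)] of [A[1/t]]. Where the chain stops,
   [s ^+ k0] is a multiple of [s ^+ k0.+1] modulo [p], up to a power of [t], and [s ^+ k0]
   cancels. *)
pose D k : set A := [set x | exists l z, p (t ^+ l * x - s ^+ k * z)].
have [|||k0 k0P] := saturated_dcc (D := D).
- move=> k; split.
  + by exists 0%N, 0; rewrite !mulr0 subrr.
  + move=> x y [l [z pz]] [l' [z' pz']]; exists (l + l')%N, (t ^+ l' * z + t ^+ l * z').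
    have -> : t ^+ (l + l') * (x + y) - s ^+ k * (t ^+ l' * z + t ^+ l * z') =
       t ^+ l' * (t ^+ l * x - s ^+ k * z) + t ^+ l * (t ^+ l' * y - s ^+ k * z').
      by rewrite exprD; ring.
    by apply: pD; apply: (pZ).
  + move=> a x [l [z pz]]; exists l, (a * z).
    have -> : t ^+ l * (a * x) - s ^+ k * (a * z) = a * (t ^+ l * x - s ^+ k * z) by ring.
    exact: pZ.
- by move=> k x [l [z pz]]; exists l.+1, z; rewrite exprSr -mulrA.
- move=> k x [l [z pz]]; exists l, (s * z).
  by rewrite mulrA -exprSr.
have [|l [z pz]] := k0P k0.+1 (leqnSn _) (s ^+ k0).
  by exists 0%N, 1; rewrite mul1r mulr1 subrr.
exists l, z; have : p (s ^+ k0 * (t ^+ l - s * z)).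
  by have -> : s ^+ k0 * (t ^+ l - s * z) = t ^+ l * s ^+ k0 - s ^+ k0.+1 * z
    by rewrite exprS; ring.
by case/pM => // /(prime_idealX pP).
Qed.

Lemma saturated_prime_sub p q : prime_ideal p -> ~ p t -> prime_ideal q -> ~ q t ->
  p `<=` q -> q `<=` p.
Proof.
move=> pP pt qP qt pq s qs; apply: contrapT => ps.
have [k [z pz]] := saturated_prime_inv pP pt ps.
apply: (prime_regularX (k := k) qP qt); have [[_ qD qZ] _ _] := qP.
rewrite -(subrK (s * z) (t ^+ k)); apply: qD; first exact: pq.
by rewrite mulrC; apply: qZ.
Qed.

(** An associated prime of [A / I]: a maximal one among the proper colon ideals [(I : r x0)], which
    are saturated because [I] is. *)
Lemma quotient_prime I x0 : ideal I -> saturated t I -> ~ I x0 ->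
  exists r, let p := [set y | I (y * (r * x0))] in prime_ideal p /\ ~ p t.
Proof.
move=> idI satI Ix0; have [I0 ID IZ] := idI.
pose Q r : set A := [set y | I (y * (r * x0))].
pose F : set (set A) := [set p | exists2 r, p = Q r & ~ I (r * x0)].
have Qid r : ideal (Q r).
  split=> [|x y|a x]; rewrite /Q /= ?mul0r //.
    by rewrite mulrDl; apply: ID.
  by rewrite -mulrA; apply: IZ.
have [||_ [r -> Irx] maxr] := @saturated_max F.
- by exists (Q 1); exists 1; rewrite // mul1r.
- by move=> _ [r -> _]; split=> // x; rewrite /Q /= -mulrA => /satI.
exists r; split; last by move=> /= /satI.
split; [exact: Qid | by rewrite /= mul1r |].
move=> y z /= Iyz; apply: contrapT => /not_orP[Iy Iz]; apply: Iz.
apply: (maxr (Q (y * r))).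
- by exists (y * r); rewrite // -mulrA.
- move=> x /= Ix; rewrite /Q /=.
  have -> : x * (y * r * x0) = y * (x * (r * x0)) by ring.
  exact: IZ.
- rewrite /Q /=.
  by have -> : z * (y * r * x0) = y * z * (r * x0) by ring.
Qed.

Lemma ann_sub_Ass b : b != 0 ->
  exists2 p, Ass A^o p & forall y, y * b = 0 -> p y.
Proof.
move=> /eqP b_neq0.
have [|||r [p_prime _]] := quotient_prime (I := [set 0]) (x0 := b).
- by split=> [//|x y -> ->|a x ->]; rewrite /= ?addr0 ?mulr0.
- by move=> x /(adic_regular At).
- by [].
exists [set y | y * (r * b) = 0]; first by split=> //; exists (r * b).
by move=> y yb; rewrite /= mulrCA yb mulr0.
Qed.

Lemma Ass_saturated q : Ass A^o q -> prime_ideal q /\ ~ q t.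
Proof.
move=> [qP [x q_def]]; split=> //; rewrite q_def => /(adic_regular At) x0.
by have [_ + _] := qP; rewrite q_def x0; apply; apply: mulr0.
Qed.

(** Take a maximal saturated [I] killed by [s q^k] for some [s] outside [q] and some [k]. If [I] is
    proper, let [p = (I : r)] be an associated prime; then [r] can be added to [I], by enlarging [s]
    when [p] is not inside [q], and by raising [k] when [p = q]. *)
Lemma prime_nilpotent q : prime_ideal q -> ~ q t ->
  exists s k, ~ q s /\ forall y, ideal_exp q k y -> s * y = 0.
Proof.
move=> qP qt; have [idq q1 qM] := qP.
pose F : set (set A) := [set I | [/\ ideal I, saturated t I & exists s k,
  ~ q s /\ forall x y, I x -> ideal_exp q k y -> s * y * x = 0]].
have [||I [idI satI [s [k [qs sq]]]] maxI] := @saturated_max F.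
- exists [set 0]; split.
  + by split=> [//|x y -> ->|a x ->]; rewrite /= ?addr0 ?mulr0.
  + by move=> x /(adic_regular At).
  + by exists 1, 0%N; split=> // x y -> _; rewrite mulr0.
- by move=> I [].
have [I0 ID IZ] := idI.
suff I1 : I 1.
  by exists s, k; split=> // y qy; rewrite -[LHS]mulr1; apply: sq.
apply: contrapT => I1; have [r] := quotient_prime idI satI I1.
rewrite mulr1; set p := [set y | _] => -[pP pt].
have [_ p1 _] := pP; apply: p1; rewrite /p /= mul1r.
(* The saturation of [I + A r]; regularity of [t] will remove the extra power. *)
pose J : set A := [set x | exists l, ideal_adj I r (t ^+ l * x)].
suff FJ : F J.
  apply: (maxI J) => //; first by move=> x Ix; exists 0%N; rewrite mul1r; apply: sub_ideal_adj.
  by exists 0%N; rewrite mul1r; apply: mem_ideal_adj.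
have [adj0 adjD adjZ] := ideal_adj_ideal r idI.
split.
- split.
  + by exists 0%N; rewrite mulr0.
  + move=> x y [l lx] [l' ly]; exists (l + l')%N.
    have -> : t ^+ (l + l') * (x + y) = t ^+ l' * (t ^+ l * x) + t ^+ l * (t ^+ l' * y).
      by rewrite exprD; ring.
    by apply: adjD; apply: adjZ.
  + by move=> a x [l lx]; exists l; rewrite mulrCA; apply: adjZ.
- by move=> x [l lx]; exists l.+1; rewrite exprSr -mulrA.
have [s' [k' [qs' kr]]] : exists s' k', ~ q s' /\ forall y, ideal_exp q k' y ->
    s * s' * y * r = 0 /\ forall x, I x -> s * s' * y * x = 0.
  have [[s' [ps' qs']]|no_s'] := pselect (exists s', p s' /\ ~ q s').
    exists s', k; split=> // y qy; split.
      have -> : s * s' * y * r = s * y * (s' * r) by ring.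
      exact: sq.
    move=> x Ix; have -> : s * s' * y * x = s * y * (s' * x) by ring.
    by apply: sq => //; apply: IZ.
  have pq : p `<=` q by move=> y py; apply: contrapT => qy; apply: no_s'; exists y.
  have qp := saturated_prime_sub pP pt qP qt pq.
  exists 1, k.+1; split=> // y qy; split; last first.
    by move=> x Ix; rewrite mulr1; apply: sq => //; apply: ideal_expS qy.
  have: ideal_exp q k.+1 `<=` [set y | s * 1 * y * r = 0].
    apply: ideal_mul_sub => [|u v qu qv].
      split=> /= [|u v eu ev|a u eu]; first by rewrite mulr0 mul0r.
        by rewrite mulrDr mulrDl eu ev addr0.
      by rewrite mulrCA -mulrA eu mulr0.
    rewrite /=; have -> : s * 1 * (u * v) * r = s * v * (u * r) by ring.
    by apply: sq => //; apply: qp.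
  exact.
exists (s * s'), k'; split; first by case/qM.
move=> x y [l [i [c [Ii xE]]]] /kr[yr yI]; apply: (adic_regularX (k := l)).
rewrite mulrCA xE mulrDr yI // add0r.
have -> : s * s' * y * (c * r) = c * (s * s' * y * r) by ring.
by rewrite yr mulr0.
Qed.

End AdicRing.

(** * Localizations at the associated primes *)

(** Here [L] is discrete: only zero maps into [K k], so the lifts of [b] are constant from index [k]
    on and [b] is their image. *)
Lemma adic_completion_nilpotent (L C : comNzRingType) (n : set L) k
    (c : {rmorphism L -> C}) :
  adic_completion n c -> (forall x, ideal_exp n k x -> x = 0) -> bijective c.
Proof.
move=> [K [idK decK cK surjK limK]] nk.
have cKk x : K k (c x) -> x = 0.
  by move=> Kx; apply: nk; rewrite -cK.
have antiK i j : (i <= j)%N -> K j `<=` K i.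
  by move=> /subnK<-; elim: (j - i)%N => //= l IHl x; rewrite addSn => /decK/IHl.
have c_inj : injective c.
  move=> x y cxy; apply/subr0_eq/cKk; rewrite rmorphB cxy subrr.
  by have [] := idK k.
have c_surj b : exists a, c a = b.
  have /choice[a aP] i := surjK i b.
  have aE i : (k <= i)%N -> a i = a k.
    move=> le_ki; apply/subr0_eq/cKk; rewrite rmorphB.
    have -> : c (a i) - c (a k) = (b - c (a k)) - (b - c (a i)) by ring.
    by apply: idealB; rewrite //; apply: antiK (aP i).
  have [|b' [b'P b'U]] := limK (fun=> a k).
    by move=> i; rewrite subrr; have [] := ideal_exp_ideal n i.
  exists (a k); rewrite -(b'U (c (a k))); last by move=> i; rewrite subrr; have [] := idK i.
  apply: b'U => i; have [le_ki|/ltnW le_ik] := leqP k i; first by rewrite -(aE i).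
  exact: antiK (aP k).
have [d dP] := choice c_surj.
by exists d => // x; apply: c_inj.
Qed.

Section Localization.
Variables (A : comNzRingType) (t : A).
Hypothesis At : adic_ring t.

Lemma localization_nilpotent (q : set A) (L : comNzRingType) (l : {rmorphism A -> L}) :
  prime_ideal q -> ~ q t -> localization q l ->
  exists k, forall y, ideal_exp q k y -> l y = 0.
Proof.
move=> qP qt [_ _ l0]; have [s [k [qs sk]]] := prime_nilpotent At qP qt.
by exists k => y /sk sy; apply/l0; exists s.
Qed.

Lemma localization_completion (q : set A) (L C : comNzRingType)
    (l : {rmorphism A -> L}) (n : set L) (c : {rmorphism L -> C}) :
  prime_ideal q -> ~ q t -> localization q l -> maximal_ideal n ->
  adic_completion n c -> localization q (c \o l).
Proof.
move=> qP qt lP; have [l_unit l_frac l0] := lP; move=> [idn n1 _] cP.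
have [k qk] := localization_nilpotent qP qt lP.
have [idq q1 qM] := qP; have [nI0 nD nZ] := idn.
(* Elements of [n ^ j] are fractions with numerator in [q ^ j]; for [j = k] they vanish, so [c] is
   bijective. *)
have nq j : ideal_exp n j `<=`
    [set x | exists s b, [/\ ~ q s, ideal_exp q j b & l s * x = l b]].
  elim: j => [|j IHj].
    by move=> x _; have [b [s [qs sx]]] := l_frac x; exists s, b.
  have [e0 eD eZ] := ideal_exp_ideal q j.+1.
  apply: ideal_mul_sub => [|x y nx /IHj[s [b [qs qb sy]]]].
    split.
    - by exists 1, 0; rewrite mulr0 rmorph0.
    - move=> x y [s [b [qs qb sx]]] [s' [b' [qs' qb' sy]]].
      exists (s * s'), (s' * b + s * b'); split; first by case/qM.
        by apply: (eD); apply: (eZ).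
      by rewrite !rmorphD !rmorphM -sx -sy /=; ring.
    - move=> a x [s [b [qs qb sx]]]; have [c' [s' [qs' sa]]] := l_frac a.
      exists (s * s'), (c' * b); split; first by case/qM.
        exact: eZ.
      by rewrite !rmorphM -sx -sa /=; ring.
  have [b' [s' [qs' sx]]] := l_frac x.
  exists (s' * s), (b' * b); split; first by case/qM.
    apply: mem_ideal_mul => //; apply: contrapT => /l_unit[w b'w]; apply: n1.
    by rewrite -b'w -sx mulrC mulrA; apply: nZ.
  by rewrite !rmorphM -sx -sy /=; ring.
have [x /nq[s [b [qs qb sx]]]|d cK dK] := adic_completion_nilpotent (k := k) cP.
  have [w sw] := l_unit s qs.
  by rewrite -[x]mul1r -sw mulrAC sx (qk _ qb) mul0r.
split=> [s /l_unit[w sw]|x|a].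
- by exists (c w); rewrite /= -rmorphM sw rmorph1.
- have [a [s [qs sx]]] := l_frac (d x).
  by exists a, s; split=> //=; rewrite -sx rmorphM dK.
- rewrite -l0 /=; split=> [ca|->]; last by rewrite rmorph0.
  by rewrite -[l a]cK ca -(rmorph0 c) cK.
Qed.

Variables (I : finType) (q : I -> set A).
Hypotheses (q_inj : injective q) (q_Ass : Ass A^o = range q).
Variables (C : I -> comNzRingType) (D : forall i, {rmorphism A -> C i}).
Hypothesis D_loc : forall i, localization (q i) (D i).

Lemma Ass_prime i : prime_ideal (q i) /\ ~ q i t.
Proof. by apply: (Ass_saturated At); rewrite q_Ass; exists i. Qed.

Lemma Ass_separated i j : i != j -> exists v, q j v /\ ~ q i v.
Proof.
move=> /eqP ij; apply: contrapT => nov.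
have qji : q j `<=` q i by move=> v qv; apply: contrapT => qiv; apply: nov; exists v.
have [[qiP qit] [qjP qjt]] := (Ass_prime i, Ass_prime j).
have qij := saturated_prime_sub At qjP qjt qiP qit qji.
by apply: ij; apply: q_inj; apply/seteqP.
Qed.

Lemma localizations_injective b : (forall i, D i b = 0) -> b = 0.
Proof.
move=> Db; apply/eqP; apply: contrapT => /negP.
move=> /(ann_sub_Ass At)[p]; rewrite q_Ass => -[i _ <-] qi.
by have [_ _ D0] := D_loc i; have /D0[s [qs /qi]] := Db i.
Qed.

Lemma localization_inv i s : ~ q i s -> exists k z, D i (s * z) = D i (t ^+ k).
Proof.
have [qP qt] := Ass_prime i => qs.
have [k [z qz]] := saturated_prime_inv At qP qt qs.
have [j qj] := localization_nilpotent qP qt (D_loc i).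
(* [y] lies in [q i], so [y ^+ j] dies in [C i]; the sum below is the cofactor of
   [s * z = t ^+ k - y] in [(t ^+ k) ^+ j - y ^+ j]. *)
pose y := t ^+ k - s * z.
exists (k * j)%N, (z * \sum_(l < j) (t ^+ k) ^+ (j.-1 - l) * y ^+ l).
have -> : s * (z * \sum_(l < j) (t ^+ k) ^+ (j.-1 - l) * y ^+ l) = t ^+ (k * j) - y ^+ j.
  by rewrite exprM subrXX mulrA /y; congr (_ * _); ring.
by rewrite rmorphB (qj (y ^+ j)) ?subr0 //; apply: mem_ideal_expX.
Qed.

(** For each [j] other than [i] some element outside [q i] dies in [C j]; the product [w] of these
    is invertible in [C i] up to a power of [t]. *)
Lemma localization_bump i (x : C i) : exists k b,
  D i b = D i (t ^+ k) * x /\ forall j, j != i -> D j b = 0.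
Proof.
have [qP qt] := Ass_prime i; have [idq q1 qM] := qP.
have /choice[v vP] j : exists v, j != i -> D j v = 0 /\ ~ q i v.
  have [->|ji] := eqVneq j i; first by exists 0.
  rewrite eq_sym in ji; have [v [qjv qiv]] := Ass_separated ji.
  have [qjP qjt] := Ass_prime j.
  have [k qk] := localization_nilpotent qjP qjt (D_loc j).
  exists (v ^+ k) => _; split; first by apply: qk; apply: mem_ideal_expX.
  by move/(prime_idealX qP).
pose w := \prod_(j | j != i) v j.
have qw : ~ q i w.
  rewrite /w; elim/big_ind: _ => // [x1 x2 qx1 qx2 /qM[]//|j /vP[_]]; exact.
have Dw j : j != i -> D j w = 0.
  by move=> ji; rewrite /w (bigD1 j) //= rmorphM; have [-> _] := vP j ji; rewrite mul0r.
have [_ D_frac _] := D_loc i; have [c [s [qs sx]]] := D_frac x.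
have [|k [z szE]] := localization_inv (i := i) (s := s * w); first by case/qM.
exists k, (c * w * z); split=> [|j ji]; last by rewrite !rmorphM /= Dw // mulr0 mul0r.
by rewrite -szE !rmorphM -sx /=; ring.
Qed.

Lemma localizations_surjective (x : forall i, C i) :
  exists k b, forall i, D i b = D i (t ^+ k) * x i.
Proof.
have /choice[k kP] i := localization_bump (x i); have [b bP] := choice kP.
(* Multiplying each summand by the powers of [t] of the other indices gives all of them the same
   exponent. *)
exists (\sum_i k i)%N, (\sum_i t ^+ (\sum_(j | j != i) k j) * b i) => i.
have Dj j : j != i -> D i (t ^+ (\sum_(l | l != j) k l) * b j) = 0.
  by move=> ji; rewrite rmorphM (proj2 (bP j)) ?mulr0 // eq_sym.
rewrite rmorph_sum (bigD1 i) //= (eq_bigr _ Dj) sumr_const mul0rn addr0.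
rewrite rmorphM (proj1 (bP i)) mulrA -rmorphM -exprD; congr (D i (t ^+ _) * _).
by rewrite [in RHS](bigD1 i) //= addnC.
Qed.

(** The [u i] are [t ^+ N] times the idempotents of [A[1/t]]: the image of [u i] is [t ^+ N] in
    [C i] and zero in the other factors, and every claim is read off there. *)
Lemma orthogonal_idempotents : exists N (u : I -> A),
  [/\ \sum_i u i = t ^+ N, forall i j, i != j -> u i * u j = 0,
      forall i j, i != j -> q i (u j)
    & forall i, exists k, forall y, ideal_exp (q i) k y -> u i * y = 0].
Proof.
have /choice[k kP] i := localization_bump (1 : C i); have [b bP] := choice kP.
pose N := (\sum_i k i)%N; pose u i := t ^+ (\sum_(j | j != i) k j) * b i.
have uu i : D i (u i) = D i (t ^+ N).
  rewrite rmorphM (proj1 (bP i)) mulr1 -rmorphM -exprD; congr (D i (t ^+ _)).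
  by rewrite /N [in RHS](bigD1 i) //= addnC.
have uv i j : j != i -> D j (u i) = 0.
  by move=> ji; rewrite rmorphM (proj2 (bP i)) ?mulr0.
exists N, u; split=> [|i j ij|i j ij|i].
- apply/subr0_eq/localizations_injective => i.
  have uji j : j != i -> D i (u j) = 0 by move=> ji; rewrite uv // eq_sym.
  by rewrite rmorphB rmorph_sum (bigD1 i) //= (eq_bigr _ uji) sumr_const mul0rn addr0 uu subrr.
- apply: localizations_injective => l; rewrite rmorphM.
  have [->|li] := eqVneq l i; first by rewrite (uv j) ?mulr0.
  by rewrite (uv i) ?mul0r.
- have [_ _ D0] := D_loc i; have [qP _] := Ass_prime i; have [idq _ qM] := qP.
  have /D0[s [qs sj]] := uv j i ij.
  have [q0 _ _] := idq.
  by have /qM[] : q i (s * u j) by rewrite sj.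
- have [qP qt] := Ass_prime i.
  have [l ql] := localization_nilpotent qP qt (D_loc i).
  exists l => y qy; apply: localizations_injective => j; rewrite rmorphM.
  have [->|ji] := eqVneq j i; first by rewrite (ql y) ?mulr0.
  by rewrite uv ?mul0r.
Qed.

End Localization.

(** * The tensor product with the fraction field *)

Lemma linear_exists (A : pzRingType) (M N : lmodType A) (f : M -> N) :
  linear f -> exists g : {linear M -> N}, g =1 f.
Proof.
move=> flin; pose fL := GRing.isLinear.Build A M N *:%R f flin.
pose g : {linear M -> N} := HB.pack_for {linear M -> N} f fL.
by exists g.
Qed.

Lemma bilinear_exists (A : nzRingType) (M N W : lmodType A) (f : M -> N -> W) :
  bilinear_for *:%R *:%R f ->
  exists g : {bilinear M -> N -> W}, forall x y, g x y = f x y.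
Proof.
move=> fbil; pose fL := bilinear_isBilinear.Build A M N W *:%R *:%R f fbil.
pose g : {bilinear M -> N -> W} := HB.pack_for {bilinear M -> N -> W} f fL.
by exists g.
Qed.

Lemma fractionP (R : idomainType) (x : {fraction R}) :
  exists n d, d != 0 /\ tofrac d * x = tofrac n.
Proof.
elim/quotW: x => r; exists \n_r, \d_r; split; first exact: denom_ratioP.
have dr := denom_ratioP r; apply/eqP.
change (FracField.mul (FracField.tofrac \d_r) (\pi_({fraction R})%qT r)
  == FracField.tofrac \n_r).
rewrite !piE FracField.equivfE /FracField.mulf !numden_Ratio ?mulf_neq0 ?oner_eq0 //.
by rewrite mulr1 mul1r mulrC.
Qed.

(** * Fractions written over powers of [a] *)

Section Denominators.
Variables (R : idomainType) (a : R).
Hypothesis a_neq0 : a != 0.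
Hypothesis a_denom : forall y, y != 0 -> exists k z, a ^+ k = z * y.

Definition inv_pow k : frac_module R := (tofrac a)^-1 ^+ k.

Lemma frac_scaleE (c : R) (x : frac_module R) :
  c *: x = (tofrac c * (x : {fraction R}) : {fraction R}).
Proof. by []. Qed.

Let fa_neq0 : tofrac a != 0. Proof. by rewrite tofrac_eq0. Qed.

Lemma inv_powD k l : a ^+ l *: inv_pow (k + l) = inv_pow k.
Proof.
rewrite frac_scaleE /inv_pow tofracXn exprD mulrCA -exprMn divff //.
by rewrite expr1n mulr1.
Qed.

Lemma inv_pow_inj k c d : c *: inv_pow k = d *: inv_pow k -> c = d.
Proof.
rewrite !frac_scaleE => /mulIf; rewrite expf_neq0 ?invr_eq0 // => /(_ isT)/eqP.
by rewrite tofrac_eq => /eqP.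
Qed.

Lemma frac_inv_pow (x : frac_module R) : exists k y, x = y *: inv_pow k.
Proof.
have [n [d [d_neq0 dx]]] := fractionP (x : {fraction R}).
have [k [z akE]] := a_denom d_neq0; exists k, (z * n).
rewrite frac_scaleE tofracM -dx mulrA -tofracM -akE tofracXn mulrAC -exprMn divff //.
by rewrite expr1n mul1r.
Qed.

End Denominators.

Section BaseChange.
Variables (R : idomainType) (a : R).
Hypothesis a_neq0 : a != 0.
Hypothesis a_denom : forall y, y != 0 -> exists k z, a ^+ k = z * y.
Variables (A : comNzRingType) (iota : {rmorphism R -> A}).
Hypothesis At : adic_ring (iota a).
Variables (I : finType) (q : I -> set A).
Hypotheses (q_inj : injective q) (q_Ass : Ass A^o = range q).
Variables (C : I -> comNzRingType) (D : forall i, {rmorphism A -> C i}).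
Hypothesis D_loc : forall i, localization (q i) (D i).
Variables (T : lmodType A) (tau : {bilinear frac_module R -> restr iota A^o -> restr iota T}).
Hypothesis T_tensor : base_change tau.

Let P : lmodType A := dsum (fun i => restr (D i) (C i)^o).
Let t := iota a.
Let e := inv_pow a.

Let DX i k (x y : C i) : D i (t ^+ k) * x = D i (t ^+ k) * y -> x = y.
Proof.
have [D_unit _ _] := D_loc i; have [qP qt] := Ass_prime At q_Ass i.
have [|w tw] := D_unit (t ^+ k); first by move/(prime_idealX qP).
by move=> /(congr1 ( *%R w)); rewrite !mulrA ![w * _]mulrC tw !mul1r.
Qed.

(** The graph of [x, b |-> x b] with values in the product of the [C i]; it is asked of all
    representations [x = y / a ^+ k], so that any convenient one may be used. *)
Let rel (x : frac_module R) (b : A) (p : P) := forall k y, x = y *: e k ->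
  forall i, D i (t ^+ k) * p i = D i (iota y * b).

Let rel_ex x b : exists p, rel x b p.
Proof.
have [k [y xE]] := frac_inv_pow a_neq0 a_denom x.
have p_ex i : exists z, D i (t ^+ k) * z = D i (iota y * b).
  have [D_unit _ _] := D_loc i; have [qP qt] := Ass_prime At q_Ass i.
  have [|w tw] := D_unit (t ^+ k); first by move/(prime_idealX qP).
  by exists (w * D i (iota y * b)); rewrite mulrA tw mul1r.
pose p : P := fun i => sval (cid (p_ex i)).
have pP i : D i (t ^+ k) * p i = D i (iota y * b) by exact: (svalP (cid (p_ex i))).
exists p => l z; rewrite xE /e -(inv_powD a_neq0 k l) -(inv_powD a_neq0 l k) [(l + k)%N]addnC.
rewrite !scalerA => /(inv_pow_inj a_neq0) yz i; apply: (DX (k := k)).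
rewrite mulrCA pP -!rmorphM; congr (D i _).
by rewrite !mulrA ![t ^+ _ * _]mulrC -!rmorphXn -!rmorphM yz.
Qed.

Let relE k y x b (p : P) : x = y *: e k ->
  (forall i, D i (t ^+ k) * p i = D i (iota y * b)) -> rel x b p.
Proof.
move=> xE pP; have [p' p'P] := rel_ex x b.
suff -> : p = p' by [].
by apply: functional_extensionality_dep => i; apply: (DX (k := k)); rewrite pP (p'P _ _ xE).
Qed.

Let rel_uniq x b p p' : rel x b p -> rel x b p' -> p = p'.
Proof.
have [k [y xE]] := frac_inv_pow a_neq0 a_denom x => pP p'P.
by apply: functional_extensionality_dep => i; apply: (DX (k := k)); rewrite (pP k y) // (p'P k y).
Qed.

(** The universal property gives [h]. Its inverse [kappa] sends [p] to [a^-k] tensor [b], where [b]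
    in [A] maps to [t ^+ k p]; injectivity of [A] into the product makes the choice of [k] and [b]
    irrelevant. *)
Lemma base_change_frac_iso : mod_iso T P.
Proof.
have [T_univ tauM] := T_tensor.
have [u uP] : exists u, forall x b, rel x b (u x b).
  by exists (fun x b => sval (cid (rel_ex x b))) => x b; apply: svalP.
have ubil : bilinear_for *:%R *:%R (u : frac_module R -> restr iota A^o -> restr iota P).
  split=> [b c x x'|x c b b'].
  - have [k [y xE]] := frac_inv_pow a_neq0 a_denom x.
    have [k' [y' xE']] := frac_inv_pow a_neq0 a_denom x'.
    apply: (rel_uniq (uP (c *: x + x') b)).
    apply: (relE (k := k + k') (y := c * (a ^+ k' * y) + a ^+ k * y')).
      rewrite xE xE' scalerDl -!scalerA; congr (c *: _ + _).
        by rewrite /e -(inv_powD a_neq0 k k') !scalerA mulrC.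
      by rewrite /e -(inv_powD a_neq0 k' k) !scalerA mulrC addnC.
    move=> i; rewrite -[LHS]/(D i (t ^+ (k + k')) * (D i (iota c) * u x b i + u x' b i)).
    have uE := uP x b _ _ xE i; have uE' := uP x' b _ _ xE' i.
    have -> : D i (t ^+ (k + k')) * (D i (iota c) * u x b i + u x' b i) =
       D i (iota c) * D i (t ^+ k') * (D i (t ^+ k) * u x b i) +
       D i (t ^+ k) * (D i (t ^+ k') * u x' b i) by rewrite exprD rmorphM; ring.
    by rewrite uE uE' /t !(rmorphD, rmorphM, rmorphXn) /=; ring.
  - have [k [y xE]] := frac_inv_pow a_neq0 a_denom x.
    apply: (rel_uniq (uP x _)); apply: (relE xE) => i.
    rewrite -[LHS]/(D i (t ^+ k) * (D i (iota c) * u x b i + u x b' i)).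
    have -> : D i (t ^+ k) * (D i (iota c) * u x b i + u x b' i) =
      D i (iota c) * (D i (t ^+ k) * u x b i) + D i (t ^+ k) * u x b' i by ring.
    rewrite (uP x b _ _ xE) (uP x b' _ _ xE) -rmorphM -rmorphD; congr (D i _).
    by rewrite -[c *: b]/(iota c * b); ring.
have [ub ubE] := bilinear_exists ubil.
have [h [hP _]] := T_univ _ ub.
have tauZl c x b : tau (c *: x) b = c *: tau x b by rewrite linearZl_LR.
have tauZr c x b : tau x (c *: b) = c *: tau x b by rewrite linearZr_LR.
have tauDr x b b' : tau x (b + b') = tau x b + tau x b' by rewrite linearDr.
have tauS x y b : tau (y *: x) b = tau x (iota y * b) by rewrite tauZl -tauZr.
have /choice[s sP] (p : P) : exists kb : nat * A, forall i, D i kb.2 = D i (t ^+ kb.1) * p i.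
  have [k [b bP]] := localizations_surjective At q_inj q_Ass D_loc p.
  by exists (k, b).
pose kappa (p : P) : T := tau (e (s p).1) (s p).2.
have kappaE p k b : (forall i, D i b = D i (t ^+ k) * p i) -> kappa p = tau (e k) b.
  move=> bP; rewrite /kappa; move: (s p) (sP p) => [k' b'] /= b'P.
  rewrite /e -(inv_powD a_neq0 k' k) -(inv_powD a_neq0 k k') !tauS [(k' + k)%N]addnC.
  congr (tau _ _); apply/subr0_eq/(localizations_injective At q_Ass D_loc) => i.
  rewrite rmorphB !rmorphM bP b'P /= !rmorphXn /= /t; ring.
have kappa_lin : linear (kappa : P -> T).
  move=> c p p'; have [k [b bP]] := localizations_surjective At q_inj q_Ass D_loc p.
  have [k' [b' bP']] := localizations_surjective At q_inj q_Ass D_loc p'.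
  rewrite (kappaE p k b) // (kappaE p' k' b') //.
  rewrite (kappaE _ (k + k')%N (c * (iota (a ^+ k') * b) + iota (a ^+ k) * b')).
    rewrite tauDr -tauS [(k + k')%N]addnC inv_powD // [(k' + k)%N]addnC; congr (_ + _).
    by rewrite tauM -tauS inv_powD.
  move=> i; rewrite -[(c *: p + p') i]/(D i c * p i + p' i).
  by rewrite !(rmorphD, rmorphM) /= bP bP' exprD rmorphM !rmorphXn /= /t; ring.
have kappah x b : kappa (h (tau x b)) = tau x b.
  rewrite hP ubE; have [k [y xE]] := frac_inv_pow a_neq0 a_denom x.
  rewrite (kappaE _ k (iota y * b)); last by move=> i; rewrite (uP x b _ _ xE).
  by rewrite -tauS xE.
have hkappa p : h (kappa p) = p.
  have [k [b bP]] := localizations_surjective At q_inj q_Ass D_loc p.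
  rewrite (kappaE p k b) // hP ubE; apply: (rel_uniq (uP _ _)).
  apply: (relE (k := k) (y := 1)); first by rewrite scale1r.
  by move=> i; rewrite rmorph1 mul1r bP.
(* Both [kappa] after [h] and the identity agree with [tau] on pure tensors, so the uniqueness
   clause for [tau] itself identifies them. *)
have kappa_h x : kappa (h x) = x.
  have [g gE] : exists g : {linear restr iota T -> restr iota T}, g =1 (fun x => kappa (h x)).
    apply: linear_exists => c y z; rewrite linearP.
    exact: (kappa_lin (iota c) (h y) (h z)).
  have [h0 [_ h0U]] := T_univ _ tau.
  have g0 : g =1 h0 by apply: h0U => y b; rewrite gE kappah.
  have [i iE] : exists g : {linear restr iota T -> restr iota T}, g =1 id.
    by apply: linear_exists.
  have i0 : i =1 h0 by apply: h0U => y b; rewrite iE.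
  by rewrite -gE g0 -i0 iE.
(* [h] is only [R]-linear by construction; [A]-linearity is inherited from its inverse [kappa]. *)
have [f fE] : exists f : {linear T -> P}, f =1 h.
  apply: linear_exists => c x y.
  by rewrite -{1}(kappa_h x) -{1}(kappa_h y) -kappa_lin hkappa.
by exists f, kappa => x; rewrite fE.
Qed.

End BaseChange.

(** * The completion of a one dimensional local domain *)

Section Completion.
Variables (R : idomainType) (m : set R).
Hypotheses (R_noetherian : noetherian_ring R) (R_local : local_ring m).
Hypothesis R_dim1 : krull_dim R 1.
Variables (a : R).
Hypotheses (a_neq0 : a != 0) (ma : m a).

Lemma dim1_exp_sub_power : exists2 n, (0 < n)%N &
  forall k x, ideal_exp m (k * n) x -> exists r, x = r * a ^+ k.
Proof.
have [n nP] := dim1_exp_sub_principal R_noetherian R_local R_dim1 a_neq0.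
exists n.+1 => // k; elim: k => [|k IHk] x.
  by move=> _; exists x; rewrite mulr1.
rewrite mulSn; apply: (ideal_exp_sub (principal_ideal (a ^+ k.+1))).
move=> _ _ /ideal_expS/nP[r ->] /IHk[s ->]; exists (r * s); rewrite exprS; ring.
Qed.

Lemma dim1_denom y : y != 0 -> exists k z, a ^+ k = z * y.
Proof.
move=> /(dim1_exp_sub_principal R_noetherian R_local R_dim1)[k kP].
by exists k; apply: kP; apply: mem_ideal_expX.
Qed.

Variables (Rh : comNzRingType) (iota : {rmorphism R -> Rh}).
Hypothesis Rh_completion : adic_completion m iota.
Let t := iota a.

(* The K k are the closures of the m ^ k; they define the t-adic topology.     *)
Lemma completion_power : exists K : nat -> set Rh,
  [/\ forall k, ideal (K k), forall k l, (k <= l)%N -> K l `<=` K k,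
      forall k, K k (t ^+ k),
      forall k, exists2 n, (k <= n)%N &
        (forall x, ideal_exp m n x -> exists r, x = r * a ^+ k) /\
        (forall b, K n b -> exists z, b = t ^+ k * z) &
      [/\ forall k x, K k (iota x) -> ideal_exp m k x,
      forall b, (forall k, K k b) -> b = 0,
      forall k b, exists x, K k (b - iota x)
    & forall x : nat -> R, (forall k, ideal_exp m k (x k.+1 - x k)) ->
      exists d, forall k, K k (d - iota (x k))]].
Proof.
have [K [idK decK preK surjK limK]] := Rh_completion.
have antiK k l : (k <= l)%N -> K l `<=` K k.
  by move=> /subnK<-; elim: (l - k)%N => //= j IHj x; rewrite addSn => /decK/IHj.
have iotaK k x : K k (iota x) -> ideal_exp m k x by rewrite -preK.
have Kiota k x : ideal_exp m k x -> K k (iota x) by rewrite -preK.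
have Kt k : K k (t ^+ k).
  by rewrite /t -rmorphXn; apply: Kiota; apply: mem_ideal_expX.
have K_lim x : (forall k, ideal_exp m k (x k.+1 - x k)) ->
    exists d, forall k, K k (d - iota (x k)).
  by move=> /limK[d [dP _]]; exists d.
have K_sep b : (forall k, K k b) -> b = 0.
  move=> Kb; have [|d [_ dU]] := limK (fun=> 0).
    by move=> k; rewrite subrr; have [] := ideal_exp_ideal m k.
  rewrite -(dU b); last by move=> k; rewrite rmorph0 subr0.
  by apply: dU => k; rewrite rmorph0 subr0; have [] := idK k.
exists K; split=> // k.
have [n n_gt0 nP] := dim1_exp_sub_power.
exists (k * n)%N; first exact: leq_pmulr.
split=> [|b Kb]; first exact: nP.
(* Consecutive [y j] differ by multiples of [a ^+ (k + j)]; dividing by [a ^+ k] leaves a convergent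
   sequence [z], whose limit is the quotient of [b] by [t ^+ k]. *)
have [y yP] := choice (fun j => surjK ((k + j) * n)%N b).
have /choice[c cP] j : exists c, y j.+1 - y j = c * a ^+ (k + j).
  apply: nP; apply: iotaK; rewrite rmorphB.
  have -> : iota (y j.+1) - iota (y j) = (b - iota (y j)) - (b - iota (y j.+1)) by ring.
  apply: idealB => //; apply: antiK (yP j.+1).
  by rewrite leq_mul2r addnS leqnSn orbT.
have [r0 y0E] : exists r, y 0%N = r * a ^+ k.
  apply: nP; apply: iotaK; have -> : iota (y 0%N) = b - (b - iota (y 0%N)) by ring.
  by apply: idealB => //; have := yP 0%N; rewrite addn0.
pose z j := r0 + \sum_(i < j) c i * a ^+ i.
have yE j : y j = z j * a ^+ k.
  elim: j => [|j IHj]; first by rewrite /z big_ord0 addr0.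
  rewrite -[y j.+1](subrK (y j)) cP IHj /z big_ord_recr /= exprD; ring.
have [j|d dP] := K_lim z.
  rewrite /z big_ord_recr /=.
  have -> : forall u v w : R, u + (v + w) - (u + v) = w by move=> u v w; ring.
  by have [_ _] := ideal_exp_ideal m j; apply; apply: mem_ideal_expX.
exists d; apply/subr0_eq/K_sep => j; have [_ KD KM] := idK j.
have -> : b - t ^+ k * d = (b - iota (y j)) + (- t ^+ k) * (d - iota (z j)).
  by rewrite yE rmorphM rmorphXn /t; ring.
apply: KD; last exact: KM.
apply: antiK (yP j); apply: leq_trans (leq_pmulr _ n_gt0).
exact: leq_addl.
Qed.

Lemma completion_dense k b : exists x z, b = iota x + t ^+ k * z.
Proof.
have [K [_ _ _ powK [_ _ surjK _]]] := completion_power.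
have [n _ [_ nP]] := powK k; have [x xP] := surjK n b.
by have [z bE] := nP _ xP; exists x, z; rewrite -bE addrC subrK.
Qed.

Lemma completion_preimage k x z : iota x = t ^+ k * z -> exists r, x = r * a ^+ k.
Proof.
have [K [idK antiK _ powK [iotaK _ surjK _]]] := completion_power.
have [n _ [nP _]] := powK k; have [y yP] := surjK n z => xE.
have [|r rE] := nP (x - a ^+ k * y).
  apply: iotaK; rewrite rmorphB rmorphM rmorphXn xE -mulrBr.
  by have [_ _] := idK n; apply.
by exists (r + y); rewrite mulrDl -rE; ring.
Qed.

Lemma completion_adic_ring : adic_ring t.
Proof.
have [K [idK antiK Kt powK [iotaK K_sep surjK K_lim]]] := completion_power.
have t_sep b : (forall k, exists z, b = t ^+ k * z) -> b = 0.
  move=> tb; apply: K_sep => k; have [z ->] := tb k.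
  by apply: idealMr.
split=> //.
(* If [b = iota x + t ^+ k * z], then [a x] is divisible by [a ^+ k.+1], hence [x] by [a ^+ k]; so
   [b] lies in every [t ^+ k Rh]. *)
- move=> b tb0; apply: t_sep => k; have [x [z bE]] := completion_dense k b.
  have [|r rE] := @completion_preimage k.+1 (a * x) (- z).
    rewrite rmorphM -/t exprS -mulrA mulrN -mulrN.
    apply/subr0_eq; rewrite -[RHS]tb0 bE; ring.
  exists (iota r + z); rewrite bE; have -> : x = r * a ^+ k.
    by apply: (mulfI a_neq0); rewrite rE exprS mulrCA.
  by rewrite rmorphM rmorphXn -/t; ring.
- move=> c; pose s k := \sum_(i < k) t ^+ i * c i.
  have sS k : s k.+1 = s k + t ^+ k * c k by rewrite /s big_ord_recr.
  have sD k j : exists z, s (k + j)%N - s k = t ^+ k * z.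
    elim: j => [|j [z IHj]]; first by exists 0; rewrite addn0 subrr mulr0.
    exists (z + t ^+ j * c (k + j)%N).
    by rewrite addnS sS addrAC IHj exprD; ring.
  (* Limits are given for sequences of [R] only, so the partial sums are approximated from [R]. *)
  have [y yP] := choice (fun k => surjK k (s k)).
  have [k|d dP] := K_lim y.
    apply: iotaK; rewrite rmorphB.
    have -> : iota (y k.+1) - iota (y k) =
      (s k - iota (y k)) - (s k.+1 - iota (y k.+1)) + t ^+ k * c k.
      by rewrite sS; ring.
    have [_ KD _] := idK k; apply: KD; last exact: idealMr.
    by apply: idealB => //; apply: antiK (yP k.+1).
  exists d => k; have [n le_kn [_ nP]] := powK k; rewrite -/(s k).
  have [z zE] : exists z, d - s n = t ^+ k * z.
    apply: nP; have -> : d - s n = (d - iota (y n)) - (s n - iota (y n)) by ring.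
    exact: idealB.
  have [z' z'E] := sD k (n - k)%N; rewrite subnKC // in z'E.
  by exists (z + z'); rewrite mulrDr -zE -z'E; ring.
- move=> I idI; have idJ := preimage_ideal iota (ideal_adj_ideal t idI).
  have [s sE] := R_noetherian idJ.
  have /choice[g gP] (j : 'I_(size s)) : exists g, I g /\ exists r, iota s`_j = g + r * t.
    have : (iota @^-1` ideal_adj I t) s`_j.
      by rewrite sE; apply: sub_ideal_gen; apply: mem_nth.
    by move=> [g [r [Ig sjE]]]; exists g; split=> //; exists r.
  have [r rP] := choice (fun j => proj2 (gP j)).
  exists (size s), g; split=> [j|x Ix]; first exact: (proj1 (gP j)).
  have [y [z xE]] := completion_dense 1 x.
  have : (iota @^-1` ideal_adj I t) y.
    by exists x, (- z); split=> //; rewrite xE expr1; ring.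
  rewrite sE => /ideal_gen_seqP[c cE].
  exists (fun j => iota (c j)), (\sum_j iota (c j) * r j + z).
  rewrite xE cE rmorph_sum expr1 mulrDr addrA mulr_sumr -big_split /=.
  by congr (_ + _); apply: eq_bigr => j _; rewrite rmorphM rP; ring.
- move=> F [I0 FI0] FP.
  pose G : set (set R) := [set J | exists2 I, F I & J = iota @^-1` I].
  have [||_ [I FI ->] maxI] := noetherian_max (F := G) R_noetherian.
  + by exists (iota @^-1` I0); exists I0.
  + by move=> _ [I /FP[idI _] ->]; apply: preimage_ideal.
  exists I => // J FJ IJ x Jx; have [[idI It] [idJ Jt]] := (FP I FI, FP J FJ).
  have [y [z xE]] := completion_dense 1 x; rewrite expr1 in xE.
  have tzI : I (t * z) by apply: idealMr.
  rewrite xE; have [_ ID _] := idI; apply: ID => //.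
  apply: (maxI (iota @^-1` J)); first by exists J.
    by move=> u; apply: IJ.
  rewrite /= -[iota y](addrK (t * z)) -xE.
  by apply: idealB => //; apply: IJ.
- move=> N D idD DN decD; have [n _ [nP _]] := powK N.
  have iotaD k : ideal (iota @^-1` D k) by apply: preimage_ideal.
  have [|||k0 k0P] := @artinian_dcc R m [set z | exists r, z = r * a ^+ N] n
     (fun k => iota @^-1` D k) R_noetherian (proj1 R_local) (principal_ideal _) nP.
  + by [].
  + by move=> k _ [r ->]; rewrite /= rmorphM rmorphXn; have [_ _] := idD k; apply.
  + by move=> k x; apply: decD.
  exists k0 => k le_k x Dx; have [y [z xE]] := completion_dense N x.
  have DNz l : D l (t ^+ N * z) by apply: idealMr.
  rewrite xE; have [_ DD _] := idD k; apply: DD => //.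
  apply: (k0P k le_k); rewrite /= -[iota y](addrK (t ^+ N * z)) -xE.
  exact: idealB.
Qed.

End Completion.

(** * The injective hull of the residue field *)

Lemma scalerC (A : comPzRingType) (M : lmodType A) (a b : A) (v : M) :
  a *: (b *: v) = b *: (a *: v).
Proof. by rewrite !scalerA mulrC. Qed.

Section Submodule.
Variables (A : comNzRingType) (M : lmodType A) (N : set M).

Definition in_submodule (subN : submodule N) : {pred M} := [pred x | `[< N x >]].

Fact in_submodule_closed subN : submod_closed (in_submodule subN).
Proof.
have [N0 ND NZ] := subN; split=> [|c x y /asboolP Nx /asboolP Ny].
  exact: asboolT.
by apply: asboolT; apply: ND => //; apply: NZ.
Qed.

HB.instance Definition _ subN :=
  GRing.isSubmodClosed.Build A M (in_submodule subN) (in_submodule_closed subN).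

Variable subN : submodule N.

Record submodule_type :=
  SubmoduleType { submodule_val : M; _ : submodule_val \in in_submodule subN }.

HB.instance Definition _ := [isSub for submodule_val].
HB.instance Definition _ := [Choice of submodule_type by <:].
HB.instance Definition _ := [SubChoice_isSubLmodule of submodule_type by <:].

(** [G] is total but constrained only on [N], so partially defined maps can be produced by
    choice. *)
Lemma injective_extend (E : lmodType A) (G : M -> E) : injective_module E ->
    (forall c x y, N x -> N y -> G (c *: x + y) = c *: G x + G y) ->
  exists h : {linear M -> E}, forall x, N x -> h x = G x.
Proof.
move=> injE Glin.
have NP (x : submodule_type) : N (submodule_val x) by case: x => x Px; apply/asboolP.
have [j jE] : exists j : {linear submodule_type -> M}, j =1 submodule_val.
  by apply: linear_exists => c x y.
have [g gE] : exists g : {linear submodule_type -> E}, g =1 G \o submodule_val.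
  by apply: linear_exists => c x y; rewrite /= -Glin.
have [|h hP] := injE _ _ j g.
  by move=> x y; rewrite !jE; apply: val_inj.
exists h => x Nx.
have Px : x \in in_submodule subN by exact: asboolT.
by have := hP (SubmoduleType Px); rewrite jE gE.
Qed.

End Submodule.

(** [e0] is the image of [1], and essentiality is tested on cyclic submodules. Hulls are used below
    only through this element and injectivity. *)
Lemma hull_of_quotient_generator (A : comNzRingType) (P : set A) (E : lmodType A) :
  hull_of_quotient P E -> exists e0 : E, (forall x, x *: e0 = 0 <-> P x) /\
    forall e : E, e <> 0 -> exists r x, r *: e <> 0 /\ r *: e = x *: e0.
Proof.
move=> [K [p [i [[p_surj p0] [_ [i_inj ess]]]]]].
have ipE x : i (p x) = x *: i (p 1).
  by rewrite -[x in LHS]mulr1 -[x * 1]/(x *: (1 : A^o)) !linearZ.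
exists (i (p 1)); split=> [x|e e_neq0].
  by rewrite -ipE -p0 -(linear0 i); split=> [/i_inj|->].
apply: contrapT => nor; apply: e_neq0.
pose N : set E := [set x | exists r, x = r *: e].
have : N e by exists 1; rewrite scale1r.
rewrite (ess N) //.
  split; first by exists 0; rewrite scale0r.
    by move=> _ _ [r ->] [s ->]; exists (r + s); rewrite scalerDl.
  by move=> c _ [r ->]; exists (c * r); rewrite scalerA.
apply/seteqP; split=> [x [[r xE] [y _ yE]]|x ->].
  have [z zE] := p_surj y; apply: contrapT => x_neq0; apply: nor.
  by exists r, z; rewrite -xE; split; [exact: x_neq0 | rewrite -ipE zE yE].
by split; exists 0; rewrite ?scale0r ?linear0.
Qed.

Section ResidueHull.
Variables (R : idomainType) (m : set R).
Hypotheses (R_noetherian : noetherian_ring R) (R_local : local_ring m).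
Hypothesis R_dim1 : krull_dim R 1.
Variables (a : R).
Hypotheses (a_neq0 : a != 0) (ma : m a).
Variables (Rh : comNzRingType) (iota : {rmorphism R -> Rh}).
Hypothesis Rh_completion : adic_completion m iota.
Variable E : lmodType Rh.
Hypothesis E_hull : hull_of_quotient m (restr iota E).
Let t := iota a.

Lemma hull_injective : injective_module (restr iota E).
Proof. by case: E_hull => K [p [i [_ []]]]. Qed.

(** Elements outside [m] act invertibly on whatever [m] kills, so essentiality makes the socle the
    line through [e0]. *)
Lemma hull_socle : exists e0 : E,
  [/\ e0 <> 0, forall x, m x -> iota x *: e0 = 0,
      forall e e' : E, e <> 0 -> (forall x, m x -> iota x *: e = 0) ->
        (forall x, m x -> iota x *: e' = 0) -> exists x, e' = iota x *: e
    & forall e : E, e <> 0 -> exists r, iota r *: e <> 0 /\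
        forall x, m x -> iota x *: (iota r *: e) = 0].
Proof.
have [e0 [ann_e0 ess_mul']] := hull_of_quotient_generator E_hull.
have ess_mul (e : E) : e <> 0 -> exists r x,
  iota r *: e <> 0 /\ iota r *: e = iota x *: (e0 : E) := ess_mul' e.
have [[idm m1 _] _] := R_local.
have me0 x : m x -> iota x *: (e0 : E) = 0 by move/ann_e0.
have e0_neq0 : e0 <> 0.
  by move=> e00; apply: m1; apply/ann_e0; rewrite e00 scaler0.
have inv_e x (e : E) : (forall x, m x -> iota x *: e = 0) -> ~ m x ->
    exists c, e = iota (c * x) *: e.
  move=> me mx; have [c mc] := maximal_ideal_inv (proj1 R_local) mx.
  exists c; apply/subr0_eq.
  by rewrite -[X in X - _]scale1r -(rmorph1 iota) -scalerBl -rmorphB me.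
have soc_e0 (e : E) : (forall x, m x -> iota x *: e = 0) -> exists x, e = iota x *: e0.
  move=> me; have [->|/eqP e_neq0] := eqVneq e 0; first by exists 0; rewrite rmorph0 scale0r.
  have [r [x [re_neq0 reE]]] := ess_mul e e_neq0.
  have [|c ->] := inv_e r e me; first by move=> /me.
  by exists (c * x); rewrite !rmorphM -!scalerA reE.
exists e0; split=> // [e e' e_neq0 me me'|e /ess_mul[r [x [re_neq0 reE]]]].
  have [[x eE] [x' e'E]] := (soc_e0 e me, soc_e0 e' me').
  have [|c cE] := inv_e x e0 me0; first by move=> /me0 xe0; apply: e_neq0; rewrite eE.
  by exists (x' * c); rewrite eE e'E {1}cE !scalerA -!rmorphM mulrA.
exists r; split=> // y my; rewrite reE scalerA -rmorphM; apply: me0.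
exact: idealMr.
Qed.

(** The annihilators of [t ^+ k *: e] become stationary. A nonzero [t ^+ k *: e] has a nonzero
    multiple in the socle, killed by [a]; its multiplier would annihilate the next term but not this
    one. *)
Lemma hull_torsion (e : E) : exists k, t ^+ k *: e = 0.
Proof.
have [e0 [_ _ _ ess]] := hull_socle.
pose An k : set R := [set r | iota r *: (t ^+ k *: e) = 0].
have [||_ [k ->] maxk] := noetherian_max (F := [set J | exists k, J = An k]) R_noetherian.
- by exists (An 0%N); exists 0%N.
- move=> _ [k ->]; split; rewrite /An /=.
  + by rewrite rmorph0 scale0r.
  + by move=> x y xe ye; rewrite rmorphD scalerDl xe ye addr0.
  + by move=> c x xe; rewrite rmorphM -scalerA xe scaler0.
exists k; apply: contrapT => /ess[r [re_neq0 mre]]; apply: re_neq0.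
apply: (maxk (An k.+1)); first by exists k.+1.
  move=> x; rewrite /An /= => xe.
  by rewrite exprS -scalerA scalerA mulrC -scalerA xe scaler0.
rewrite /An /= exprS -scalerA scalerA mulrC -scalerA.
exact: mre.
Qed.

(* Only the R-module E is known to be injective: as g vanishes near 0, it      *)
(* descends to an ideal of Rh / t ^ s = R / a ^ s.                             *)
Lemma hull_baer (J : set Rh) (g : Rh -> E) s : ideal J ->
    (forall c x y, J x -> J y -> g (c * x + y) = c *: g x + g y) ->
    (forall z, J (t ^+ s * z) -> g (t ^+ s * z) = 0) ->
  exists e, forall j, J j -> g j = j *: e.
Proof.
move=> idJ glin gs; have [J0 JD JM] := idJ.
have g0 : g 0 = 0 by have := gs 0; rewrite mulr0; apply.
pose N : set R^o := [set x | exists j z, J j /\ iota x = j + t ^+ s * z].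
have subN : submodule N.
  split; first by exists 0, 0; rewrite rmorph0 mulr0 addr0.
    move=> x y [j [z [Jj xE]]] [j' [z' [Jj' yE]]]; exists (j + j'), (z + z').
    by split; [apply: JD | rewrite rmorphD xE yE; ring].
  move=> c x [j [z [Jj xE]]]; exists (iota c * j), (iota c * z).
  by split; [apply: JM | rewrite -[c *: x]/(c * x) rmorphM xE; ring].
have /choice[G GP] (x : R) : exists e, forall j z, J j -> iota x = j + t ^+ s * z -> e = g j.
  have [[j [z [Jj xE]]]|noj] := pselect (N x); last first.
    by exists 0 => j z Jj xE; case: noj; exists j, z.
  exists (g j) => j' z' Jj' xE'.
  have jE : j - j' = t ^+ s * (z' - z).
    by rewrite -[j](addrK (t ^+ s * z)) -xE xE'; ring.
  have Jjj : J (t ^+ s * (z' - z)) by rewrite -jE; apply: idealB.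
  have := glin 1 (j - j') j' (idealB idJ Jj Jj') Jj'.
  by rewrite mul1r subrK jE gs // scaler0 add0r.
have [|h hE] := @injective_extend R R^o N subN (restr iota E) G hull_injective.
  move=> c x y [j [z [Jj xE]]] [j' [z' [Jj' yE]]].
  rewrite (GP _ (iota c * j + j') (iota c * z + z')).
  - by rewrite glin // (GP x j z) // (GP y j' z').
  - by apply: JD => //; apply: JM.
  - by rewrite -[c *: x]/(c * x) rmorphD rmorphM xE yE; ring.
pose e : E := h 1.
have hE1 x : h x = iota x *: e.
  by rewrite -[x in LHS]mulr1 -[x * 1]/(x *: (1 : R^o)) linearZ.
exists e => j Jj; have [x [z jE]] :=
  completion_dense R_noetherian R_local R_dim1 a_neq0 ma Rh_completion s j.
(* [a ^+ s] has component zero in [J]. As [t ^+ s] kills [e], approximation modulo [t ^+ s] carries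
   the formula from [R] to [Rh]. *)
have te : t ^+ s *: e = 0.
  rewrite -rmorphXn -hE1 hE.
    by rewrite (GP _ 0 1) ?rmorphXn ?mulr1 ?add0r.
  by exists 0, 1; rewrite rmorphXn mulr1 add0r.
rewrite {2}jE scalerDl mulrC -scalerA te scaler0 addr0 -hE1 hE.
  by rewrite (GP x j (- z)) // jE; ring.
by exists j, (- z); split=> //; rewrite jE; ring.
Qed.

(** Devissage from [I0 = Ann f]: whatever is killed by the annihilator of [I f] lies in [I f]. *)
Lemma hull_double_annihilator (f g : E) :
  (forall x, x *: f = 0 -> x *: g = 0) -> exists c, g = c *: f.
Proof.
move=> fg; have [e0 [_ _ soc ess]] := hull_socle.
have idm : ideal m by have [[]] := R_local.
pose I0 : set R := [set x | iota x *: f = 0].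
have idI0 : ideal I0.
  split; rewrite /I0 /=; first by rewrite rmorph0 scale0r.
    by move=> x y xf yf; rewrite rmorphD scalerDl xf yf addr0.
  by move=> c x xf; rewrite rmorphM -scalerA xf scaler0.
have [N mI0] : exists N, ideal_exp m N `<=` I0.
  have [k tkf] := hull_torsion f.
  have [n _ nP] := dim1_exp_sub_power R_noetherian R_local R_dim1 a_neq0.
  exists (k * n)%N => x /nP[r ->].
  by rewrite /I0 /= rmorphM rmorphXn -scalerA tkf scaler0.
pose P (I : set R) := forall g : E,
  (forall x, (forall y, I y -> iota (x * y) *: f = 0) -> iota x *: g = 0) ->
  exists2 y, I y & g = iota y *: f.
suff: P setT.
  move=> /(_ g)[x xf|y _ ->]; last by exists (iota y).
  by apply: fg; rewrite -(mulr1 x); apply: xf.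
apply: (devissage (m := m) R_noetherian idI0 mI0).
  move=> h hP; exists 0; first by case: idI0.
  rewrite rmorph0 scale0r -[h]scale1r -(rmorph1 iota); apply: hP => y.
  by rewrite mul1r.
move=> I y idI I0I PI myI h hP; have [_ ID IM] := idI.
(* If everything killing [I f] kills [y f], the annihilator does not change. Otherwise [x0 y f]
   spans the socle, which contains [x0 h], and subtracting a multiple of [y f] from [h] reduces to
   [I]. *)
have [[x0 [x0I x0y]]|nox0] := pselect (exists x0,
    (forall z, I z -> iota (x0 * z) *: f = 0) /\ iota (x0 * y) *: f <> 0); last first.
  have [x xI|z Iz ->] := PI h; last by exists z => //; apply: sub_ideal_adj.
  apply: hP => _ [z [r [Iz ->]]]; rewrite mulrDr rmorphD scalerDl xI // add0r.
  rewrite mulrCA rmorphM -scalerA.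
  have [->|/eqP xy] := eqVneq (iota (x * y) *: f) 0; first by rewrite scaler0.
  by case: nox0; exists x.
have adjP x : (forall z, I z -> iota (x * z) *: f = 0) -> iota (x * y) *: f = 0 ->
    iota x *: h = 0.
  move=> xI xy; apply: hP => _ [z [r [Iz ->]]].
  by rewrite mulrDr rmorphD scalerDl xI // add0r mulrCA rmorphM -scalerA xy scaler0.
have x_soc x : (forall z, I z -> iota (x * z) *: f = 0) ->
    forall b, m b -> iota b *: (iota (x * y) *: f) = 0.
  by move=> xI b mb; rewrite scalerA -rmorphM mulrCA; apply: xI; apply: myI.
have [r rE] : exists r, iota x0 *: h = iota r *: (iota (x0 * y) *: f).
  apply: soc => // [|b mb]; first exact: x_soc.
  rewrite scalerA -rmorphM; apply: adjP => [z Iz|].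
    by rewrite -mulrA rmorphM -scalerA x0I // scaler0.
  by rewrite -mulrA rmorphM -scalerA x_soc.
have [x xI|z Iz zE] := PI (h - iota (r * y) *: f); last first.
  exists (z + r * y); first by exists z, r.
  by rewrite rmorphD scalerDl -zE subrK.
have [c cE] : exists c, iota (x * y) *: f = iota c *: (iota (x0 * y) *: f).
  by apply: soc => //; apply: x_soc.
have : iota (x - c * x0) *: h = 0.
  apply: adjP => [z Iz|];
    rewrite mulrBl rmorphB scalerBl -[c * x0 * _]mulrA [iota (c * _)]rmorphM -scalerA.
    by rewrite xI // x0I // scaler0 subrr.
  by rewrite cE subrr.
rewrite rmorphB scalerBl => /subr0_eq xh; rewrite scalerBr xh.
have -> : iota x *: (iota (r * y) *: f) = iota r *: (iota (x * y) *: f).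
  by rewrite !scalerA -!rmorphM mulrCA.
rewrite cE [iota (c * _)]rmorphM -scalerA rE; move: (iota (x0 * y) *: f) => w.
by rewrite !scalerA [iota c * _]mulrC subrr.
Qed.

(** Modulo [t], [b] comes from some [x] in [R]. If [x] is outside [m], some [1 - c x] is nilpotent
    modulo [a], and a geometric sum inverts [x] there. *)
Lemma hull_socle_unit : exists e0 : E, [/\ e0 <> 0, t *: e0 = 0 &
  forall b, b *: e0 = 0 \/ exists c z, 1 = c * b + t * z].
Proof.
have [e0 [e0_neq0 me0 _ _]] := hull_socle.
have [n _ nP] := dim1_exp_sub_power R_noetherian R_local R_dim1 a_neq0.
exists e0; split=> [//||b]; first exact: me0.
have [x [y bE]] := completion_dense R_noetherian R_local R_dim1 a_neq0 ma Rh_completion 1 b.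
rewrite expr1 in bE; have [mx|mx] := pselect (m x).
  by left; rewrite bE scalerDl mulrC -scalerA !me0 // scaler0 addr0.
right; have [c mc] := maximal_ideal_inv (proj1 R_local) mx.
have [r rE] : exists r, (1 - c * x) ^+ n = r * a.
  by rewrite -[a]expr1; apply: nP; rewrite mul1n; apply: mem_ideal_expX.
pose s := \sum_(i < n) 1 ^+ (n.-1 - i) * (1 - c * x) ^+ i.
have e1 : 1 = s * c * x + r * a.
  rewrite -rE; apply/subr0_eq; rewrite opprD addrCA addrC.
  have := subrXX 1 (1 - c * x) n; rewrite expr1n -/s => ->; ring.
exists (iota (s * c)), (iota r - iota (s * c) * y).
rewrite -[LHS](rmorph1 iota) [in LHS]e1 bE rmorphD [iota (r * a)]rmorphM -/t.
by rewrite [iota (s * c * x)]rmorphM; ring.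
Qed.

End ResidueHull.

(** * Homomorphisms from the fraction field *)

Section LimitModule.
Variables (A : comNzRingType) (t : A).
Hypothesis At : adic_ring t.
Variable E : lmodType A.
Hypothesis E_torsion : forall e : E, exists k, t ^+ k *: e = 0.
Hypothesis E_baer : forall (J : set A) (g : A -> E) s, ideal J ->
    (forall c x y, J x -> J y -> g (c * x + y) = c *: g x + g y) ->
    (forall z, J (t ^+ s * z) -> g (t ^+ s * z) = 0) ->
  exists e, forall j, J j -> g j = j *: e.
Hypothesis E_double_annihilator : forall f g : E,
  (forall x, x *: f = 0 -> x *: g = 0) -> exists c, g = c *: f.
Hypothesis E_socle : exists e0 : E, [/\ e0 <> 0, t *: e0 = 0 &
  forall b, b *: e0 = 0 \/ exists c z, 1 = c * b + t * z].

(* V is the inverse limit of E <- E <- E <- ... along multiplication by t,     *)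
(* with projections ev n.                                                      *)
Variables (V : lmodType A) (ev : nat -> V -> E).
Hypothesis ev_lin : forall n, linear (ev n).
Hypothesis evS : forall n v, t *: ev n.+1 v = ev n v.
Hypothesis ev_inj : forall v, (forall n, ev n v = 0) -> v = 0.
Hypothesis ev_ex : forall s : nat -> E, (forall n, t *: s n.+1 = s n) ->
  exists v, forall n, ev n v = s n.

Lemma ev0 n : ev n 0 = 0.
Proof.
by have := ev_lin n 1 0 0; rewrite !scale1r addr0 => /esym/(canRL (addrK _)); rewrite subrr.
Qed.

Lemma evZ n c v : ev n (c *: v) = c *: ev n v.
Proof. by rewrite -[c *: v]addr0 ev_lin ev0 addr0. Qed.

Lemma evD n v w : ev n (v + w) = ev n v + ev n w.
Proof. by rewrite -[v]scale1r ev_lin !scale1r. Qed.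

Lemma evB n v w : ev n (v - w) = ev n v - ev n w.
Proof. by rewrite evD -scaleN1r evZ scaleN1r. Qed.

Lemma ev_eq v w : (forall n, ev n v = ev n w) -> v = w.
Proof. by move=> vw; apply/subr0_eq/ev_inj => n; rewrite evB vw subrr. Qed.

Lemma evSX n k v : t ^+ k *: ev (n + k) v = ev n v.
Proof.
elim: k => [|k IHk]; first by rewrite addn0 scale1r.
by rewrite addnS exprSr -scalerA evS.
Qed.

Lemma limit_regular k (v : V) : t ^+ k *: v = 0 -> v = 0.
Proof.
move=> tv; apply: ev_inj => n; rewrite -(evSX n k) -evZ tv.
exact: ev0.
Qed.

Lemma limit_divisible k (v : V) : exists w, t ^+ k *: w = v.
Proof.
have [n|w wE] := ev_ex (s := fun n => ev (n + k) v); first by rewrite addSn evS.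
by exists w; apply: ev_eq => n; rewrite evZ wE evSX.
Qed.

Lemma limit_lift (P : nat -> E -> Prop) e0 : P 0%N e0 ->
    (forall n e, P n e -> exists e', P n.+1 e' /\ t *: e' = e) ->
  exists v, ev 0 v = e0 /\ forall n, P n (ev n v).
Proof.
move=> P0 PS; have /choice[F FP] (ne : nat * E) : exists e', P ne.1 ne.2 ->
    P ne.1.+1 e' /\ t *: e' = ne.2.
  have [/PS[e' e'P]|] := pselect (P ne.1 ne.2); first by exists e'.
  by exists 0.
pose s := fix s n := if n is n'.+1 then F (n', s n') else e0.
have Ps n : P n (s n) by elim: n => //= n IHn; case: (FP (n, s n) IHn).
have [n|v vE] := ev_ex (s := s); first by case: (FP (n, s n) (Ps n)).
by exists v; split=> [|n]; rewrite vE.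
Qed.

(** Saturation makes [j + r t |-> r y] well defined on [J + t A]; it kills multiples of [t ^+ s.+1]
    when [t ^+ s] kills [y], so [E_baer] represents it by the required [z]. *)
Lemma annihilated_divisible (J : set A) (y : E) : ideal J -> saturated t J ->
    (forall j, J j -> j *: y = 0) ->
  exists z, (forall j, J j -> j *: z = 0) /\ t *: z = y.
Proof.
move=> idJ satJ Jy; have [J0 _ _] := idJ; have [s ty] := E_torsion y.
have /choice[g gP] (x : A) : exists e, forall j r, J j -> x = j + r * t -> e = r *: y.
  have [[j [r [Jj xE]]]|nox] := pselect (ideal_adj J t x); last first.
    by exists 0 => j r Jj xE; case: nox; exists j, r.
  exists (r *: y) => j' r' Jj' xE'; apply/subr0_eq; rewrite -scalerBl Jy //.
  apply: satJ; have -> : t * (r - r') = j' - j.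
    by rewrite -[j](addrK (r * t)) -xE xE'; ring.
  exact: idealB.
have gE j r : J j -> g (j + r * t) = r *: y by move=> Jj; exact: (gP _ j r Jj erefl).
have [|||e eE] := E_baer (J := ideal_adj J t) (g := g) (s := s.+1).
- exact: ideal_adj_ideal.
- move=> c _ _ [j [r [Jj ->]]] [j' [r' [Jj' ->]]]; rewrite !gE // scalerA -scalerDl.
  apply: (gP _ (c * j + j')); last by ring.
  by have [_ JD JM] := idJ; apply: JD => //; apply: JM.
- move=> z _; rewrite (gP _ 0 (z * t ^+ s)) //; last by rewrite exprS; ring.
  by rewrite -scalerA ty scaler0.
exists e; split=> [j Jj|].
  rewrite -eE; last exact: sub_ideal_adj.
  by rewrite (gP _ j 0) ?scale0r // mul0r addr0.
rewrite -eE; last exact: mem_ideal_adj.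
by rewrite (gP _ 0 1) ?scale1r // mul1r add0r.
Qed.

(** [E_baer] represents [g] at each level. The mismatch between consecutive levels is killed by [J],
    so [annihilated_divisible] corrects it without changing the action on [J]. *)
Lemma limit_baer (J : set A) (g : A -> V) : ideal J -> saturated t J ->
    (forall c x y, J x -> J y -> g (c * x + y) = c *: g x + g y) ->
  exists v, forall j, J j -> g j = j *: v.
Proof.
move=> idJ satJ glin; have [J0 JD JM] := idJ.
have g0 : g 0 = 0.
  have := glin 1 0 0 J0 J0; rewrite mul1r scale1r addr0.
  by move=> /esym/(canRL (addrK _)); rewrite subrr.
have gZ c x : J x -> g (c * x) = c *: g x.
  by move=> Jx; have := glin c x 0 Jx J0; rewrite !addr0 g0 addr0.
have [k [b [Jb bgen]]] := saturated_fin_gen At idJ.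
have ev_ext n : exists e, forall j, J j -> ev n (g j) = j *: e.
  have [s0 s0P] := choice (fun i => E_torsion (ev n (g (b i)))).
  pose s := (\sum_i s0 i)%N.
  have sb i : t ^+ s *: ev n (g (b i)) = 0.
    by rewrite /s (bigD1 i) //= addnC exprD -scalerA s0P scaler0.
  apply: (E_baer (s := s)) => // [c x y Jx Jy|z Jtz].
    by rewrite glin // ev_lin.
  (* Artin-Rees is trivial for saturated [J]; and [t ^+ s] kills the values on generators, hence on
     [J]. *)
  have Jz : J z by apply: saturatedX Jtz.
  rewrite gZ // evZ.
  have [r ->] := bgen J idJ satJ (fun _ => id) (@sub_ideal_adj _ J t) z Jz.
  pose I : set A := [set x | J x /\ t ^+ s *: ev n (g x) = 0].
  suff [] : I (\sum_j r j * b j) by [].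
  apply: ideal_sum => [|j].
    split; first by split=> //; rewrite g0 ev0 scaler0.
      move=> x y [Jx tx] [Jy ty]; split; first exact: JD.
      by have := glin 1 x y Jx Jy; rewrite mul1r scale1r => ->; rewrite evD scalerDr tx ty addr0.
    move=> c x [Jx tx]; split; first exact: JM.
    by rewrite gZ // evZ scalerA mulrC -scalerA tx scaler0.
  split; first exact: JM.
  by rewrite gZ // evZ scalerA mulrC -scalerA sb scaler0.
have [e0 e0P] := ev_ext 0%N.
have [|v [_ vP]] := @limit_lift (fun n e => forall j, J j -> ev n (g j) = j *: e) e0 e0P.
  move=> n e eP; have [e1 e1P] := ev_ext n.+1.
  have [j Jj|z [Jz tz]] := annihilated_divisible (y := e - t *: e1) idJ satJ.
    by rewrite scalerBr -eP // scalerA mulrC -scalerA -e1P // evS subrr.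
  exists (e1 + z); split=> [j Jj|]; first by rewrite scalerDr Jz // addr0 e1P.
  by rewrite scalerDr tz addrC subrK.
by exists v => j Jj; apply: ev_eq => n; rewrite vP // evZ.
Qed.

(** * Elements of [V] killed by a saturated prime *)

Section Prime.
Variable q : set A.
Hypotheses (q_prime : prime_ideal q) (qt : ~ q t).

Let idq : ideal q. Proof. by case: q_prime. Qed.

Lemma limit_inv (M : lmodType A) (v : M) s : (forall x, q x -> x *: v = 0) -> ~ q s ->
  exists k z, t ^+ k *: v = z *: (s *: v).
Proof.
move=> qv /(saturated_prime_inv At q_prime qt)[k [z qz]]; exists k, z.
by apply/subr0_eq; rewrite scalerA mulrC -scalerBl qv.
Qed.

(** [q] kills [e0], since an element of [q] invertible modulo [t] would force [q = A]. Lifting [e0]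
    among elements killed by [q] gives [w]; an [x] outside [q] killing [w] would make a power of [t]
    kill it. *)
Lemma limit_annihilated : exists w : V, forall x, x *: w = 0 <-> q x.
Proof.
have [e0 [e0_neq0 te0 e0P]] := E_socle.
have qe0 x : q x -> x *: e0 = 0.
  move=> qx; have [//|[c [z e1]]] := e0P x.
  have [_ q1 _] := q_prime; case: q1; have [_ _ qM] := idq.
  have idT : ideal (setT : set A) by [].
  apply: (saturated_sub At idq idT) => //.
  by move=> y _; exists (y * c * x), (y * z); split; [apply: qM | rewrite -[LHS]mulr1 e1; ring].
have [|w [w0 qw]] := @limit_lift (fun _ e => forall x, q x -> x *: e = 0) e0 qe0.
  by move=> _ e /(annihilated_divisible idq (prime_saturated q_prime qt)).
have {}qw x : q x -> x *: w = 0.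
  move=> qx; apply: ev_inj => n; rewrite evZ; exact: qw.
exists w => x; split=> [xw|]; last exact: qw.
apply: contrapT => /(limit_inv qw)[k [z]].
rewrite xw scaler0 => /limit_regular w_eq0; apply: e0_neq0.
by rewrite -w0 w_eq0 ev0.
Qed.

(* Chevalley's argument: the annihilators of the f n decrease to the           *)
(* annihilator q of f, hence they are eventually contained in q + t A.         *)
Lemma limit_annihilator_small (f : V) : f <> 0 -> (forall x, q x -> x *: f = 0) ->
  exists n, forall x, x *: ev n f = 0 -> ideal_adj q t x.
Proof.
move=> f_neq0 qf; apply: contrapT => noN.
pose An n : set A := [set x | x *: ev n f = 0].
have idA n : ideal (An n).
  split; rewrite /An /=; first by rewrite scale0r.
    by move=> x y xf yf; rewrite scalerDl xf yf addr0.
  by move=> c x xf; rewrite -scalerA xf scaler0.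
have AS n : An n.+1 `<=` An n.
  by move=> x; rewrite /An /= => xf; rewrite -evS scalerA mulrC -scalerA xf scaler0.
pose D k n := ideal_adj (An n) (t ^+ k).
have idD k n : ideal (D k n) by exact: ideal_adj_ideal.
have DS k n : D k n.+1 `<=` D k n.
  by move=> _ [x [r [Ax ->]]]; exists x, r; split=> //; apply: AS.
have /choice[s sP] k : exists n0, forall n, (n0 <= n)%N -> D k n0 `<=` D k n.
  by apply: (adic_dcc At (N := k)) => // n; apply: mem_ideal_adj.
have Danti k l n : (l <= n)%N -> D k n `<=` D k l.
  by move=> /subnK<-; elim: (n - l)%N => //= j IHj x; rewrite addSn => /DS/IHj.
(* The stable value of the chain [D k n] in [n]. Its elements lift from [k] to [k.+1] by corrections
   in [t ^+ k A]; the limit [d] of the lifts of [x0] kills [f] but stays outside [q]. *)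
pose J k : set A := [set x | forall n, D k n x].
have DJ k x : D k (s k) x -> J k x.
  move=> Dx n; have [/sP|/ltnW/Danti] := leqP (s k) n; exact.
have JS k x : J k x -> exists z, J k.+1 (x + t ^+ k * z).
  move=> /(_ (s k.+1))[i [r [Ai ->]]]; exists (- r).
  have -> : i + r * t ^+ k + t ^+ k * - r = i by ring.
  by apply: DJ; apply: sub_ideal_adj.
have [x0 [A0 x0q]] : exists x, An (s 1%N) x /\ ~ ideal_adj q t x.
  apply: contrapT => nox; apply: noN; exists (s 1%N) => x Ax.
  by apply: contrapT => nx; apply: nox; exists x.
have J0 : J 1%N x0 by apply: DJ; apply: sub_ideal_adj.
have /choice[F FP] (kx : nat * A) : exists z, J kx.1 kx.2 -> J kx.1.+1 (kx.2 + t ^+ kx.1 * z).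
  have [/JS[z zP]|] := pselect (J kx.1 kx.2); first by exists z.
  by exists 0.
pose y := fix y k := if k is k'.+1 then y k' + t ^+ k * F (k, y k') else x0.
have Jy k : J k.+1 (y k) by elim: k => // k IHk; exact: (FP (k.+1, y k)).
pose c k := if k is k'.+1 then F (k, y k') else x0.
have cE k : \sum_(i < k.+1) t ^+ i * c i = y k.
  elim: k => [|k IHk]; first by rewrite big_ord1 expr0 mul1r.
  by rewrite big_ord_recr /= IHk.
have [d dP] := adic_complete At c.
have Jd k : J k.+1 d.
  move=> n; have [z ->] := dP k.+1; rewrite cE; have [_ DD _] := idD k.+1 n.
  by apply: DD; [exact: Jy | apply: idealMr => //; apply: mem_ideal_adj].
have df : d *: f = 0.
  apply: ev_inj => n; rewrite evZ; have [k tk] := E_torsion (ev n f).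
  have [i [r [Ai ->]]] := Jd k n.
  by rewrite scalerDl Ai add0r exprS mulrA -scalerA tk scaler0.
have qd : ~ q d.
  move=> qd; apply: x0q; have [z dE] := dP 1%N.
  exists d, (- z); split=> //.
  by rewrite dE big_ord1 /= expr0 expr1; ring.
have [k [z]] := limit_inv qf qd.
by rewrite df scaler0 => /limit_regular.
Qed.

(** The annihilators of the [ev l f] shrink [t]-adically towards [q], so the multipliers [d l] given
    by double annihilation converge modulo [q], and their limit is the ratio. *)
Lemma limit_one_dim (f g : V) : f <> 0 -> (forall x, q x -> x *: f = 0) ->
  (forall x, q x -> x *: g = 0) -> exists k d, t ^+ k *: g = d *: f.
Proof.
move=> f_neq0 qf qg; have [n nP] := limit_annihilator_small f_neq0 qf.
have qfn l x : q x -> x *: ev l f = 0.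
  by move=> qx; rewrite -evZ qf // ev0.
have qgn l x : q x -> x *: ev l g = 0.
  by move=> qx; rewrite -evZ qg // ev0.
have annP k x : x *: ev (n + k) f = 0 -> exists y z, q y /\ x = y + t ^+ k.+1 * z.
  elim: k x => [|k IHk] x.
    by rewrite addn0 => /nP[y [z [qy ->]]]; exists y, z; rewrite mulrC.
  move=> xf; have [y [z [qy xE]]] : ideal_adj q t x.
    by apply: nP; rewrite -(evSX n k.+1) scalerA mulrC -scalerA xf scaler0.
  have [|y' [z' [qy' zE]]] := IHk z.
    rewrite -evS scalerA -addnS -[z * t](addKr y) -xE scalerDl xf addr0 scaleNr.
    by rewrite qfn ?oppr0.
  exists (y + t * y'), z'; split; last by rewrite xE zE !exprS; ring.
  by have [_ qD qM] := idq; apply: qD => //; apply: qM.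
(* Multiplying by [t ^+ k] makes [h] vanish at index [n], where control of the annihilators
   starts. *)
have [k tg] := E_torsion (ev n g).
pose h := t ^+ k *: g.
have qh l x : q x -> x *: ev l h = 0.
  by move=> qx; rewrite evZ scalerA mulrC -scalerA qgn ?scaler0.
have h0 : ev n h = 0 by rewrite evZ.
have /choice[d dP] l : exists c, ev (n + l) h = c *: ev (n + l) f.
  apply: E_double_annihilator => x /annP[y [z [qy ->]]].
  rewrite scalerDl qh // add0r (_ : t ^+ l.+1 * z = z * t * t ^+ l).
    by rewrite -scalerA evSX h0 scaler0.
  by rewrite exprS; ring.
have /choice[yz yzP] l : exists yz : A * A, q yz.1 /\ d l.+1 - d l = yz.1 + t ^+ l.+1 * yz.2.
  have [|y [z [qy dE]]] := annP l (d l.+1 - d l); last by exists (y, z).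
  rewrite scalerBl -dP -[X in d l.+1 *: X]evS -addnS scalerA mulrC -scalerA -dP addnS evS.
  by rewrite subrr.
pose c l := if l is l'.+1 then (yz l').2 else d 0%N.
have [d0 d0P] := adic_complete At c.
have qc l : q (\sum_(i < l.+1) t ^+ i * c i - d l).
  elim: l => [|l IHl]; first by rewrite big_ord1 expr0 mul1r subrr; case: idq.
  have [qy dE] := yzP l; rewrite big_ord_recr /=.
  have -> : forall u v w : A, u + v - w = (u - d l) - (w - d l - v) by move=> u v w; ring.
  by apply: idealB => //; rewrite dE addrK.
have [s ts] := E_torsion (ev n f).
exists k, d0; rewrite -/h; apply/subr0_eq/(limit_regular (k := s))/ev_inj => l.
rewrite -(evSX l n) addnC evZ evB evZ dP.
have [w wE] := d0P l.+1.
rewrite -scalerBl (_ : d l - d0 =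
  - (\sum_(i < l.+1) t ^+ i * c i - d l) - w * t * t ^+ l); last by rewrite wE exprS; ring.
rewrite scalerBl scaleNr qfn ?oppr0 ?sub0r // -scalerA evSX.
rewrite !scalerN [t ^+ s *: _]scalerA [t ^+ s * _]mulrC.
by rewrite -[(_ * t ^+ s) *: _]scalerA ts !scaler0 oppr0.
Qed.

End Prime.

(** * Decomposition of [V] along the idempotents *)

Variables (I : finType) (q : I -> set A) (N : nat) (u : I -> A).
Hypothesis q_prime : forall i, prime_ideal (q i) /\ ~ q i t.
Hypothesis u_sum : \sum_i u i = t ^+ N.
Hypothesis u_orth : forall i j, i != j -> u i * u j = 0.
Hypothesis qu : forall i j, i != j -> q i (u j).
Hypothesis u_nilp : forall i, exists k, forall y, ideal_exp (q i) k y -> u i * y = 0.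
Variable Ei : I -> lmodType A.
Hypothesis Ei_hull : forall i, hull_of_quotient (q i) (Ei i).

Lemma idempotent_sqr i : u i * u i = t ^+ N * u i.
Proof.
rewrite -u_sum mulr_suml (bigD1 i) //= big1 ?addr0 // => j ji.
by rewrite u_orth.
Qed.

Lemma annihilated_idempotent i (M : lmodType A) (w : M) :
  (forall x, q i x -> x *: w = 0) -> u i *: w = t ^+ N *: w.
Proof.
move=> qw; rewrite -u_sum (bigD1 i) //= scalerDl scaler_suml big1 ?addr0 // => j ji.
by apply: qw; apply: qu; rewrite eq_sym.
Qed.

(** [h] extends [c w |-> c e], where [w] and [e] both have annihilator [q i]. One-dimensionality
    gives injectivity on [u i V]; [limit_baer] and essentiality of [Ei i] give surjectivity. *)
Lemma limit_component i : exists h : {linear V -> Ei i},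
  (forall v, h (u i *: v) = 0 -> u i *: v = 0) /\
  (forall x, exists v, h (u i *: v) = x).
Proof.
have [qP qt] := q_prime i; have [idq q1 qM] := qP; have [q0 qD qZ] := idq.
have [w wP] := limit_annihilated qP qt.
have qw x : q i x -> x *: w = 0 by move/wP.
have w_neq0 : w <> 0 by move=> w0; apply: q1; apply/wP; rewrite w0 scaler0.
have [e [eP ess]] := hull_of_quotient_generator (Ei_hull i).
have injEi : injective_module (Ei i) by have [K [p [j [_ []]]]] := Ei_hull i.
have [h hw] : exists h : {linear V -> Ei i}, forall c, h (c *: w) = c *: e.
  pose M : set V := [set v | exists c, v = c *: w].
  have subM : submodule M.
    split; first by exists 0; rewrite scale0r.
      by move=> _ _ [c ->] [d ->]; exists (c + d); rewrite scalerDl.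
    by move=> b _ [c ->]; exists (b * c); rewrite scalerA.
  have /choice[G GP] (v : V) : exists x, forall c, v = c *: w -> x = c *: e.
    have [[c vE]|nov] := pselect (M v); last by exists 0 => c vE; case: nov; exists c.
    exists (c *: e) => d vE'; apply/subr0_eq; rewrite -scalerBl; apply/eP/wP.
    by rewrite scalerBl -vE -vE' subrr.
  have [|h hE] := injective_extend subM (E := Ei i) (G := G) injEi.
    move=> b _ _ [c ->] [d ->]; rewrite (GP (c *: w) c) // (GP (d *: w) d) //.
    by rewrite [in RHS]scalerA -scalerDl; apply: GP; rewrite scalerDl scalerA.
  by exists h => c; rewrite hE; [exact: GP | exists c].
have hZ c v : h (c *: v) = c *: h v by exact: linearZ_LR.
have h_inj v : h (u i *: v) = 0 -> u i *: v = 0.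
  move=> huv; apply: contrapT => uv_neq0; have [k uk] := u_nilp i.
  (* The last power of [q i] not killing [u i *: v] yields a nonzero element killed by [q i],
     proportional to [w] up to a power of [t]; there [h] is faithful. *)
  have [l [s [ql sv]] qlS] : exists2 l, exists s, ideal_exp (q i) l s /\ s *: (u i *: v) <> 0 &
      forall y, ideal_exp (q i) l.+1 y -> y *: (u i *: v) = 0.
    have : forall y, ideal_exp (q i) k y -> y *: (u i *: v) = 0.
      by move=> y /uk uy; rewrite scalerA mulrC uy scale0r.
    elim: k {uk} => [|k IHk] qk; first by case: uv_neq0; rewrite -[RHS](qk 1) // scale1r.
    have [/IHk //|nk] := pselect (forall y, ideal_exp (q i) k y -> y *: (u i *: v) = 0).
    exists k => //; apply: contrapT => nos; apply: nk => y qy.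
    by apply: contrapT => yv; apply: nos; exists y.
  have [|l' [d dE]] := limit_one_dim qP qt (f := w) (g := s *: (u i *: v)) w_neq0 qw.
    by move=> x qx; rewrite scalerA; apply: qlS; apply: mem_ideal_mul.
  apply: sv; apply: (limit_regular (k := l')); rewrite dE; apply: qw.
  apply/eP; rewrite -hw -dE !hZ; have := huv; rewrite hZ => ->.
  by rewrite !scaler0.
exists h; split=> // x.
pose J : set A := [set r | exists v, h (u i *: v) = r *: x].
have idJ : ideal J.
  split; first by exists 0; rewrite scaler0 linear0 scale0r.
    by move=> r s [v vE] [v' v'E]; exists (v + v'); rewrite scalerDr linearD vE v'E scalerDl.
  move=> c r [v vE]; exists (c *: v).
  by rewrite scalerC hZ vE scalerA.
have regEi k (z : Ei i) : t ^+ k *: z = 0 -> z = 0.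
  move=> tz; apply: contrapT => /ess[r [c [rz rzE]]]; apply: rz; rewrite rzE; apply/eP.
  apply: (prime_regular_mul qP qt (k := k)); apply/eP.
  by rewrite -scalerA -rzE scalerC tz scaler0.
have satJ : saturated t J.
  move=> r [v vE]; have [v' v'E] := limit_divisible 1 v; exists v'.
  apply/subr0_eq; apply: (regEi 1%N).
  by rewrite scalerBr -hZ scalerC v'E vE expr1 scalerA subrr.
have /choice[g gP] (r : A) : exists y, forall v, h (u i *: v) = r *: x -> y = u i *: v.
  have [[v vE]|nov] := pselect (J r); last by exists 0 => v vE; case: nov; exists v.
  exists (u i *: v) => v' vE'; apply/subr0_eq; rewrite -scalerBr; apply: h_inj.
  by rewrite scalerBr linearB vE vE' subrr.
have [|y yP] := limit_baer (g := g) idJ satJ.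
  move=> c r s [v vE] [v' v'E]; rewrite (gP r v) // (gP s v') // (gP _ (c *: v + v')).
    by rewrite scalerDr scalerC.
  by rewrite scalerDr linearD scalerC hZ vE v'E scalerDl scalerA.
(* [g] has values in [u i V], where [u i] acts as [t ^+ N]; dividing [y] by [t ^+ N] compensates. *)
have [y' y'E] := limit_divisible N y; exists y'.
have yJ r : J r -> r *: (x - h (u i *: y')) = 0.
  move=> [v vE]; apply: (regEi N).
  have uuv : t ^+ N *: h (u i *: v) = h (u i *: (u i *: v)).
    by rewrite -hZ !scalerA idempotent_sqr.
  rewrite !scalerBr -vE uuv -(gP r v) // yP; last by exists v.
  by rewrite -y'E [r *: (_ *: y')]scalerC !(hZ, scalerC (u i)) subrr.
apply/esym/subr0_eq; apply: contrapT => /ess[r [c [rz rzE]]]; apply: rz.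
apply: yJ; have [w' w'E] := limit_divisible N w.
(* If [r] carries the difference [x - h (u i *: y')] to [c *: e = h (c *: w)], this witness shows
   that [r] is in [J], which kills the difference. *)
exists (c *: w' + r *: y').
rewrite scalerDr linearD [u i *: (c *: _)]scalerC.
rewrite (annihilated_idempotent (i := i) (w := w')); last first.
  move=> z qz; apply: (limit_regular (k := N)).
  by rewrite scalerC w'E qw.
rewrite w'E hw -rzE [u i *: (r *: _)]scalerC [h (r *: _)]hZ.
by rewrite scalerBr subrK.
Qed.

(** The sum of the [u i] is [t ^+ N], which acts bijectively on [V], and orthogonality separates the
    components. *)
Lemma limit_iso : mod_iso V (dsum Ei).
Proof.
have [f fE] : exists f : {linear V -> dsum Ei}, forall v i,
   f v i = sval (cid (limit_component i)) (u i *: v).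
  have [|f fE] := @linear_exists A V (dsum Ei)
      (fun v i => sval (cid (limit_component i)) (u i *: v)).
    move=> c v w; apply: functional_extensionality_dep => i.
    by rewrite scalerDr scalerC linearD linearZ_LR.
  by exists f => v i; rewrite fE.
have h_inj i v : f v i = 0 -> u i *: v = 0.
  by rewrite fE; case: cid => h [/= + _]; apply.
have h_surj i (x : Ei i) : exists v, f v i = x.
  by have [v <-] := proj2 (svalP (cid (limit_component i))) x; exists v; rewrite fE.
have f_inj : injective f.
  move=> v w fvw; apply/subr0_eq/(limit_regular (k := N)).
  rewrite -u_sum scaler_suml big1 // => i _; apply: h_inj.
  by rewrite linearB fvw subrr.
have f_surj x : exists v, f v = x.
  have /choice[v vP] i : exists v, f v i = x i by apply: h_surj.
  have /choice[v' v'P] i := limit_divisible N (v i).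
  exists (\sum_i u i *: v' i); apply: functional_extensionality_dep => i.
  rewrite -vP !fE; congr (_ _).
  rewrite -v'P (bigD1 i) //= scalerDr scaler_sumr big1 ?addr0 => [|j ji].
    by rewrite scalerA idempotent_sqr mulrC -scalerA.
  by rewrite scalerA u_orth ?scale0r // eq_sym.
have [d dP] := choice f_surj.
by exists f, d => // v; apply: f_inj; rewrite dP.
Qed.

End LimitModule.

(** * [Hom(Q, E)] as the inverse limit of [E] along multiplication by [a] *)

Section HomFraction.
Variables (R : idomainType) (a : R).
Hypothesis a_neq0 : a != 0.
Hypothesis a_denom : forall y, y != 0 -> exists k z, a ^+ k = z * y.
Variables (Rh : comNzRingType) (iota : {rmorphism R -> Rh}) (E : lmodType Rh).

Local Notation V := (modhom iota (frac_module R) E).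
Definition modhom_ev n (v : V) : E := modhom_fun v (inv_pow a n).

Lemma modhom_linear (v : V) c x y :
  modhom_fun v (c *: x + y) = iota c *: modhom_fun v x + modhom_fun v y.
Proof. by case: v => g gP; have /asboolP := gP; apply. Qed.

Lemma modhom_scale (v : V) c x : modhom_fun v (c *: x) = iota c *: modhom_fun v x.
Proof.
have v0 : modhom_fun v 0 = 0.
  have := modhom_linear v 1 0 0; rewrite !scale1r rmorph1 scale1r addr0.
  by move=> /esym/(canRL (addrK _)); rewrite subrr.
by rewrite -[c *: x]addr0 modhom_linear v0 addr0.
Qed.

Lemma modhom_ev_linear n : linear (modhom_ev n).
Proof. by []. Qed.

Lemma modhom_evS n v : iota a *: modhom_ev n.+1 v = modhom_ev n v.
Proof. by rewrite /modhom_ev -modhom_scale -(inv_powD a_neq0 n 1) expr1 addn1. Qed.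

Lemma modhom_ev_inj v : (forall n, modhom_ev n v = 0) -> v = 0.
Proof.
move=> v0; apply: val_inj; apply: funext => x.
have [k [y ->]] := frac_inv_pow a_neq0 a_denom x.
by rewrite /= modhom_scale [modhom_fun v _]v0 scaler0.
Qed.

Lemma modhom_ev_ex (s : nat -> E) : (forall n, iota a *: s n.+1 = s n) ->
  exists v, forall n, modhom_ev n v = s n.
Proof.
move=> sS; have sX k l : iota (a ^+ l) *: s (k + l)%N = s k.
  elim: l => [|l IHl]; first by rewrite addn0 rmorph1 scale1r.
  by rewrite addnS exprSr rmorphM -scalerA sS.
have /choice[g gP] (x : frac_module R) : exists e, forall k y,
    x = y *: inv_pow a k -> e = iota y *: s k.
  have [k [y xE]] := frac_inv_pow a_neq0 a_denom x.
  exists (iota y *: s k) => l z; rewrite xE -(inv_powD a_neq0 k l) -(inv_powD a_neq0 l k).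
  rewrite [(l + k)%N]addnC !scalerA => /(inv_pow_inj a_neq0) yz.
  by rewrite -(sX k l) -(sX l k) [(l + k)%N]addnC !scalerA -!rmorphM yz.
have ghom : g \in is_hom iota (M := frac_module R) (E := E).
  apply: asboolT => c x x'.
  have [k [y xE]] := frac_inv_pow a_neq0 a_denom x.
  have [k' [y' xE']] := frac_inv_pow a_neq0 a_denom x'.
  rewrite (gP _ (k + k')%N (c * (y * a ^+ k') + y' * a ^+ k)); last first.
    rewrite xE xE' -(inv_powD a_neq0 k k') -(inv_powD a_neq0 k' k) [(k' + k)%N]addnC.
    by rewrite !scalerA -scalerDl mulrA.
  rewrite -[RHS]/(iota c *: g x + g x') (gP x k y) // (gP x' k' y') //.
  rewrite -(sX k k') -(sX k' k) [(k' + k)%N]addnC !scalerA -scalerDl.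
  by rewrite rmorphD !rmorphM mulrA.
exists (ModHom ghom) => n; rewrite /modhom_ev /= (gP _ n 1) ?rmorph1 ?scale1r //.
Qed.

End HomFraction.

Theorem theorem2p5
  (R : idomainType) (m : set R)
  (R_noetherian : noetherian_ring R)
  (R_local : local_ring m)
  (R_dim1 : krull_dim R 1)
  (* Rh is the m-adic completion of R *)
  (Rh : comNzRingType) (iota : {rmorphism R -> Rh})
  (Rh_completion : adic_completion m iota)
  (* E is E_R(R/m), with its compatible Rh-module structure *)
  (E : lmodType Rh)
  (E_hull : hull_of_quotient m (restr iota E))
  (* Ass Rh = {q_1, ..., q_r} *)
  (r : nat) (q : 'I_r -> set Rh)
  (q_inj : injective q)
  (q_Ass : Ass Rh^o = range q)
  (* Ei i is E_Rh(Rh/q_i) *)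
  (Ei : 'I_r -> lmodType Rh)
  (Ei_hull : forall i, hull_of_quotient (q i) (Ei i))
  (* L i is the localization of Rh at q_i, with maximal ideal n i,
     and C i is the completion of L i *)
  (L : 'I_r -> comNzRingType) (l : forall i, {rmorphism Rh -> L i})
  (L_localization : forall i, localization (q i) (l i))
  (n : forall i, set (L i))
  (n_maximal : forall i, maximal_ideal (n i))
  (C : 'I_r -> comNzRingType) (c : forall i, {rmorphism L i -> C i})
  (C_completion : forall i, adic_completion (n i) (c i))
  (* T is the tensor product of Q and Rh over R *)
  (T : lmodType Rh)
  (t : {bilinear frac_module R -> restr iota Rh^o -> restr iota T})
  (T_tensor : base_change t) :
  mod_iso (modhom iota (frac_module R) E) (dsum Ei) /\
  mod_iso T (dsum (fun i => restr (c i \o l i) (C i)^o)).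
Proof.
have [a a_neq0 ma] := dim1_nonzero R_noetherian R_local R_dim1.
have a_denom := dim1_denom R_noetherian R_local R_dim1 ma.
have At := completion_adic_ring R_noetherian R_local R_dim1 a_neq0 ma Rh_completion.
have q_prime i : prime_ideal (q i) /\ ~ q i (iota a) := Ass_prime At q_Ass i.
(* From here on the completed rings enter only as localizations of [Rh]. *)
have D_loc i : localization (q i) (c i \o l i).
  have [qP qt] := q_prime i.
  exact (localization_completion At qP qt (L_localization i) (n_maximal i) (C_completion i)).
split; last first.
  exact: (base_change_frac_iso a_neq0 a_denom At q_inj q_Ass D_loc T_tensor).
have [N [u [u_sum u_orth qu u_nilp]]] := orthogonal_idempotents At q_inj q_Ass D_loc.
have E_tors := hull_torsion R_noetherian R_local ma E_hull.
have E_dann := hull_double_annihilator R_noetherian R_local R_dim1 a_neq0 ma E_hull.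
have E_soc := hull_socle_unit R_noetherian R_local R_dim1 a_neq0 ma Rh_completion E_hull.
have E_baer := hull_baer R_noetherian R_local R_dim1 a_neq0 ma Rh_completion E_hull.
exact: (limit_iso At E_tors E_baer E_dann E_soc (@modhom_ev_linear R a Rh iota E)
  (modhom_evS a_neq0 (E := E)) (modhom_ev_inj a_neq0 a_denom (E := E))
  (modhom_ev_ex a_neq0 a_denom (E := E)) q_prime u_sum u_orth qu u_nilp Ei_hull).
Qed.
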